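(* Consider the algorithm DIST-OPT described in the context, run with the linear voltage model $v(p,q)=Rp+Xq+v_0\mathbf 1$. Assume Problem (P) satisfies Slater's condition: there exist $p,q\in\mathbb R^N$ with $\underline p<p<\bar p$, $\underline q<q<\bar q$ and $\underline v<v(p,q)<\bar v$ (all inequalities componentwise and strict). Assume all communication delays are bounded by $\tau_{\max}\in\mathbb Z_{\ge 0}$, and let the step size satisfy $$0<\gamma<\frac{2}{\bigl(1+((\tau_{\max}+1)d+1)\sqrt N\bigr)L},\qquad L=\frac{2(\|R\|^2+\|X\|^2)}{a_{\min}}.$$ Then $\lim_{t\to\infty}(p(t),q(t))=(p^\star,q^\star)$, where $(p^\star,q^\star)$ is the (unique) optimal solution of Problem (P).
   Context: Network: a radial network is a tree on nodes $\{0,1,\dots,N\}$ rooted at node $0$; $\mathcal N=\{1,\dots,N\}$. Each $i\in\mathcal N$ has a unique parent $\sigma_i\in\{0,\dots,N\}$. Each edge $(h,k)$ ($h$ the parent of $k$) has resistance $r_{hk}\ge0$ and reactance $x_{hk}\ge0$. $\mathcal P_i$ is the set of edges on the path from $0$ to $i$. Define $N\times N$ matrices $R_{ij}=2\sum_{(h,k)\in\mathcal P_i\cap\mathcal P_j}r_{hk}$ and $X_{ij}=2\sum_{(h,k)\in\mathcal P_i\cap\mathcal P_j}x_{hk}$. $\texttt{dist}(i,j)$ is the number of edges on the tree path between $i$ and $j$, and $d=\max_{i,j\in\mathcal N}\texttt{dist}(i,j)$. Voltage model: $v(p,q)=Rp+Xq+v_0\mathbf 1\in\mathbb R^N$ for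 a fixed $v_0\in\mathbb R$. $\|\cdot\|$ is the Euclidean norm on vectors and the spectral norm on matrices. Problem (P): given vectors $\underline v\le\bar v$, $\underline p\le\bar p$, $\underline q\le\bar q$ in $\mathbb R^N$ and reals $a_i^{P},a_i^{Q}>0$, $b_i^P,b_i^Q,c_i^P,c_i^Q$, minimize over $p,q\in\mathbb R^N$ the cost $\sum_{i=1}^N(\tfrac{a_i^P}{2}p_i^2+b_i^Pp_i+c_i^P)+\sum_{i=1}^N(\tfrac{a_i^Q}{2}q_i^2+b_i^Qq_i+c_i^Q)$ subject to $\underline v\le v(p,q)\le\bar v$, $\underline p\le p\le\bar p$, $\underline q\le q\le\bar q$. Let $a_{\min}=\min\{a_1^P,\dots,a_N^P,a_1^Q,\dots,a_N^Q\}$. Algorithm DIST-OPT. For $i\in\mathcal N$, the algorithmic parent of $i$ is $\sigma_i$ if $\sigma_i\neq0$; if $\sigma_i=0$, $i$ has no algorithmic parent. Let $\mathcal C_i=\{j\in\mathcal N:\sigma_j=i\}$. For each $j\in\mathcal N$ having an algorithmic parent and each $t\in\mathbb N$, there are delays $\tau^{\uparrow}_j(t),\tau^{\downarrow}_j(t)\in\mathbb Z_{\ge0}$, all bounded by $\tau_{\max}$. Write $[x]_a^b=\min(\max(x,a),b)$ and $\lceil x\rceil_+=\max(x,0)$. Initialization ($t=0$): for all $i\in\mathcal N$, $z_i^P(0)=z_i^Q(0)=\underline\lambda_i(0)=\bar\lambda_i(0)=\lambda_i(0)=0$ and $\alpha_i(0)=\beta_i^P(0)=\beta_i^Q(0)=\hat\alpha_i(0)=\hat\beta_i^P(0)=\hat\beta_i^Q(0)=0$;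 any message $\alpha_i(s),\beta_i^P(s),\beta_i^Q(s)$ with $s<0$ is $0$; if $i$ has no algorithmic parent then $\hat\beta_i^P(t)=\hat\beta_i^Q(t)=0$ for all $t$. For $t=0,1,2,\dots$ and every $i\in\mathcal N$: (1) $p_i(t)=\bigl[(z_i^P(t)-b_i^P)/a_i^P\bigr]_{\underline p_i}^{\bar p_i}$ and $q_i(t)=\bigl[(z_i^Q(t)-b_i^Q)/a_i^Q\bigr]_{\underline q_i}^{\bar q_i}$. (2) $v(t)=v(p(t),q(t))$; $\underline\lambda_i(t+1)=\lceil\underline\lambda_i(t)+\gamma(\underline v_i-v_i(t))\rceil_+$, $\bar\lambda_i(t+1)=\lceil\bar\lambda_i(t)+\gamma(v_i(t)-\bar v_i)\rceil_+$, $\lambda_i(t+1)=\underline\lambda_i(t+1)-\bar\lambda_i(t+1)$, with step size $\gamma>0$. (3) $\alpha_i(t+1)=\lambda_i(t+1)+\sum_{j\in\mathcal C_i}\hat\alpha_j(t)$, and for each $j\in\mathcal C_i$: $\beta_j^P(t+1)=R_{ii}\bigl(\lambda_i(t+1)+\sum_{r\in\mathcal C_i\setminus\{j\}}\hat\alpha_r(t)\bigr)+\hat\beta_i^P(t)$ and $\beta_j^Q(t+1)=X_{ii}\bigl(\lambda_i(t+1)+\sum_{r\in\mathcal C_i\setminus\{j\}}\hat\alpha_r(t)\bigr)+\hat\beta_i^Q(t)$. For each $j$ with an algorithmic parent: $\hat\alpha_j(t+1)=\alpha_j(t+1-\tau^{\uparrow}_j(t))$, $\hat\beta_j^P(t+1)=\beta_j^P(t+1-\tau^{\downarrow}_j(t))$,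 $\hat\beta_j^Q(t+1)=\beta_j^Q(t+1-\tau^{\downarrow}_j(t))$. (4) $z_i^P(t+1)=R_{ii}\bigl(\lambda_i(t+1)+\sum_{j\in\mathcal C_i}\hat\alpha_j(t+1)\bigr)+\hat\beta_i^P(t+1)$ and $z_i^Q(t+1)=X_{ii}\bigl(\lambda_i(t+1)+\sum_{j\in\mathcal C_i}\hat\alpha_j(t+1)\bigr)+\hat\beta_i^Q(t+1)$. *)

(* Defs.v *)
From Stdlib Require Import Reals Lra Lia List Arith Bool.
Import ListNotations.
Open Scope R_scope.

(* Nodes of the network are 0..N (0 = root); the non-root nodes are 1..N.
   Vectors in R^N are functions nat -> R, meaningful on indices 1..N.
   Matrices are functions nat -> nat -> R, meaningful on 1..N x 1..N. *)

Definition sumN (N : nat) (f : nat -> R) : R :=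
  fold_right Rplus 0 (map f (seq 1 N)).

Definition vnorm (N : nat) (x : nat -> R) : R :=
  sqrt (sumN N (fun i => x i * x i)).

Definition matvec (N : nat) (M : nat -> nat -> R) (x : nat -> R) : nat -> R :=
  fun i => sumN N (fun j => M i j * x j).

Definition is_spectral_norm (N : nat) (M : nat -> nat -> R) (nR : R) : Prop :=
  is_lub (fun y => exists x, vnorm N x <= 1 /\ y = vnorm N (matvec N M x)) nR.

Definition par (sigma : nat -> nat) (i : nat) : nat :=
  if Nat.eqb i 0 then 0%nat else sigma i.

Definition is_radial_tree (N : nat) (sigma : nat -> nat) : Prop :=
  forall i, (1 <= i <= N)%nat ->
    (sigma i <= N)%nat /\ exists m, Nat.iter m (par sigma) i = 0%nat.

(* anc k i : node k (in 1..N) is i or an ancestor of i, i.e. the edge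
   (sigma_k, k) lies on the path P_i from 0 to i.  Edges are identified
   with their child endpoint k. *)
Definition anc (N : nat) (sigma : nat -> nat) (k i : nat) : bool :=
  negb (Nat.eqb k 0) &&
  existsb (fun m => Nat.eqb (Nat.iter m (par sigma) i) k) (seq 0 (S N)).

(* R_ij = 2 * sum_{(h,k) in P_i cap P_j} r_hk, with r k = r_{sigma_k k}. *)
Definition pathmat (N : nat) (sigma : nat -> nat) (r : nat -> R) : nat -> nat -> R :=
  fun i j => 2 * sumN N (fun k => if anc N sigma k i && anc N sigma k j then r k else 0).

(* dist(i,j): number of edges on the tree path between i and j, i.e. the
   edges in the symmetric difference of P_i and P_j. *)
Definition dist (N : nat) (sigma : nat -> nat) (i j : nat) : nat :=
  length (filter (fun k => xorb (anc N sigma k i) (anc N sigma k j)) (seq 1 N)).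

Definition diam (N : nat) (sigma : nat -> nat) : nat :=
  fold_right Nat.max 0%nat
    (flat_map (fun i => map (fun j => dist N sigma i j) (seq 1 N)) (seq 1 N)).

Definition amin (N : nat) (aP aQ : nat -> R) : R :=
  fold_right Rmin (aP 1%nat) (map aP (seq 1 N) ++ map aQ (seq 1 N)).

Definition volt (N : nat) (Rm Xm : nat -> nat -> R) (v0 : R) (p q : nat -> R) : nat -> R :=
  fun i => matvec N Rm p i + matvec N Xm q i + v0.

Definition cost (N : nat) (aP bP cP aQ bQ cQ : nat -> R) (p q : nat -> R) : R :=
  sumN N (fun i => aP i / 2 * p i ^ 2 + bP i * p i + cP i)
  + sumN N (fun i => aQ i / 2 * q i ^ 2 + bQ i * q i + cQ i).

Definition feasible (N : nat) (Rm Xm : nat -> nat -> R) (v0 : R)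
  (vlo vup plo pup qlo qup : nat -> R) (p q : nat -> R) : Prop :=
  forall i, (1 <= i <= N)%nat ->
    vlo i <= volt N Rm Xm v0 p q i <= vup i /\
    plo i <= p i <= pup i /\ qlo i <= q i <= qup i.

Definition optimal (N : nat) (Rm Xm : nat -> nat -> R) (v0 : R)
  (vlo vup plo pup qlo qup aP bP cP aQ bQ cQ : nat -> R) (p q : nat -> R) : Prop :=
  feasible N Rm Xm v0 vlo vup plo pup qlo qup p q /\
  forall p' q', feasible N Rm Xm v0 vlo vup plo pup qlo qup p' q' ->
    cost N aP bP cP aQ bQ cQ p q <= cost N aP bP cP aQ bQ cQ p' q'.

Definition clamp (x a b : R) : R := Rmin (Rmax x a) b.
Definition posp (x : R) : R := Rmax x 0.

Definition sumC (N : nat) (sigma : nat -> nat) (i : nat) (f : nat -> R) : R :=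
  sumN N (fun j => if Nat.eqb (sigma j) i then f j else 0).

Definition sumC' (N : nat) (sigma : nat -> nat) (i j : nat) (f : nat -> R) : R :=
  sumN N (fun r => if Nat.eqb (sigma r) i && negb (Nat.eqb r j) then f r else 0).

Definition delayed (m : nat -> R) (t tau : nat) : R :=
  if Nat.leb tau t then m (t - tau)%nat else 0.

(* Main.v *)
(* The messages deliver prices z(t) = R lam(t) + error, where the error comes
   only from the off-diagonal entries of R (a node knows its own multiplier
   without delay) and is controlled by the variation of lam over the last
   D = (taumax + 1) * diam steps.  DIST-OPT is thus projected gradient ascent on
   the dual function with stale gradients.  Strong convexity of the cost gives
     dual(t+1) - dual(t) >= |dmu|^2 / gamma - (curvature loss) - (delay loss),
   and summing in time bounds sum |dmu|^2 as soon as
     gamma * L * (1 + 2 c D) < 2,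
   where c |R| bounds the norm of the off-diagonal part of R.  On a tree one may
   take c = 1 - 1/N, and 2 (1 - 1/N) <= sqrt N yields the announced step size
   (with c = 1 the argument would fail for N = 2, 3).  Slater's condition bounds
   the multipliers.  Since the increments of the multipliers vanish, the
   projection inequality makes y(t) = (p(t), q(t)) Cauchy, and its limit ystar satisfies
   cost(y) >= cost(ystar) + (amin/2) |y - ystar|^2 for every
   feasible y, which is optimality and uniqueness at once. *)

Require Import Defs.
From Stdlib Require Import Reals Lra Lia List Arith Bool Psatz.
From Coquelicot Require Import Coquelicot.
Open Scope R_scope.

(** * Finite sums *)

(** The messages use only the diagonal entries R_ii, and the tree restores the others. If k lies
    below i then R_ik = R_ii; otherwise R_ik equals the entry of the parent of i at k, so what node
    i lacks is exactly what its parent sends down. A hop costs one update and at most [taumax] steps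
    of transit, whence a staleness of (taumax + 1) dist(i,k). The 2 in L arises because prices see
    only the difference of the lower and upper multipliers, whose squared increment is at most 2
    |dmu|^2. The delay loss at time t involves older increments, so a single step may lower the dual
    value. Only the time sum is controlled: an increment enters at most D later windows. Convergence
    is proved for the powers and not for the multipliers. Iterates of two times t and s are compared
    directly: the multipliers of each time are a test point in the projection inequality of the
    other, and the costs cancel. *)

Lemma sumN_0 f : sumN 0 f = 0.
Proof. reflexivity. Qed.

Lemma sumN_S N f : sumN (S N) f = sumN N f + f (S N).
Proof.
  unfold sumN. rewrite seq_S, map_app, fold_right_app. simpl.
  generalize (f (S N)); intros a.
  induction (map f (seq 1 N)) as [|b l IH]; simpl; [lra|rewrite IH; lra].
Qed.

Lemma sumN_ext N f g :
  (forall i, (1 <= i <= N)%nat -> f i = g i) -> sumN N f = sumN N g.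
Proof.
  induction N as [|N IH]; intros H; [reflexivity|].
  rewrite !sumN_S, H by lia. f_equal. apply IH. intros; apply H; lia.
Qed.

Lemma sumN_le N f g :
  (forall i, (1 <= i <= N)%nat -> f i <= g i) -> sumN N f <= sumN N g.
Proof.
  induction N as [|N IH]; intros H; [rewrite !sumN_0; lra|].
  rewrite !sumN_S. apply Rplus_le_compat; [apply IH; intros|]; apply H; lia.
Qed.

Lemma sumN_plus N f g : sumN N (fun i => f i + g i) = sumN N f + sumN N g.
Proof. induction N; rewrite ?sumN_0, ?sumN_S; lra. Qed.

Lemma sumN_minus N f g : sumN N (fun i => f i - g i) = sumN N f - sumN N g.
Proof. induction N; rewrite ?sumN_0, ?sumN_S; lra. Qed.

Lemma sumN_opp N f : sumN N (fun i => - f i) = - sumN N f.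
Proof. induction N; rewrite ?sumN_0, ?sumN_S; lra. Qed.

Lemma sumN_scal N a f : sumN N (fun i => a * f i) = a * sumN N f.
Proof. induction N; rewrite ?sumN_0, ?sumN_S; nra. Qed.

Lemma sumN_scalr N a f : sumN N (fun i => f i * a) = sumN N f * a.
Proof. induction N; rewrite ?sumN_0, ?sumN_S; nra. Qed.

Lemma sumN_zero N : sumN N (fun _ => 0) = 0.
Proof. induction N; rewrite ?sumN_0, ?sumN_S; lra. Qed.

Lemma sumN_const N a : sumN N (fun _ => a) = INR N * a.
Proof. induction N; rewrite ?sumN_0, ?sumN_S, ?S_INR; simpl; lra. Qed.

Lemma sumN_ge0 N f :
  (forall i, (1 <= i <= N)%nat -> 0 <= f i) -> 0 <= sumN N f.
Proof. intros H. rewrite <- (sumN_zero N). apply sumN_le, H. Qed.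

Lemma sumN_abs N f : Rabs (sumN N f) <= sumN N (fun i => Rabs (f i)).
Proof.
  induction N; rewrite ?sumN_0, ?sumN_S; [rewrite Rabs_R0; lra|].
  eapply Rle_trans; [apply Rabs_triang|lra].
Qed.

Lemma sumN_swap N M (f : nat -> nat -> R) :
  sumN N (fun i => sumN M (f i)) = sumN M (fun j => sumN N (fun i => f i j)).
Proof.
  induction N; rewrite ?sumN_0, ?sumN_S.
  - symmetry; apply sumN_zero.
  - rewrite IHN, <- sumN_plus. apply sumN_ext; intros. now rewrite sumN_S.
Qed.

Lemma sumN_term_le N f k : (1 <= k <= N)%nat ->
  (forall i, (1 <= i <= N)%nat -> 0 <= f i) -> f k <= sumN N f.
Proof.
  induction N as [|N IH]; intros Hk H; [lia|]. rewrite sumN_S.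
  assert (0 <= sumN N f) by (apply sumN_ge0; intros; apply H; lia).
  destruct (Nat.eq_dec k (S N)) as [->|]; [lra|].
  assert (0 <= f (S N)) by (apply H; lia).
  assert (f k <= sumN N f) by (apply IH; [lia|intros; apply H; lia]). lra.
Qed.

Lemma sumN_single N f k : (1 <= k <= N)%nat ->
  sumN N (fun i => if Nat.eqb i k then f i else 0) = f k.
Proof.
  induction N as [|N IH]; intros Hk; [lia|]. rewrite sumN_S.
  destruct (Nat.eqb_spec (S N) k) as [<-|].
  - rewrite (sumN_ext _ _ (fun _ => 0)), sumN_zero; [lra|].
    intros i Hi. destruct (Nat.eqb_spec i (S N)); [lia|reflexivity].
  - rewrite IH by lia. lra.
Qed.

Lemma sumN_cauchy_schwarz N f g :
  sumN N (fun i => f i * g i) ^ 2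
  <= sumN N (fun i => f i ^ 2) * sumN N (fun i => g i ^ 2).
Proof.
  set (a := sumN N (fun i => f i ^ 2)). set (b := sumN N (fun i => f i * g i)).
  set (c := sumN N (fun i => g i ^ 2)).
  assert (Hc : 0 <= c) by (apply sumN_ge0; intros; nra).
  assert (H : forall s, 0 <= a + 2 * s * b + s ^ 2 * c).
  { intros s. unfold a, b, c. rewrite <- !sumN_scal, <- !sumN_plus.
    apply sumN_ge0. intros i _. pose proof (pow2_ge_0 (f i + s * g i)). nra. }
  destruct (Req_dec c 0) as [Hc0|Hc0].
  - assert (b = 0); [|nra].
    destruct (Req_dec b 0) as [|Hb]; [easy|exfalso].
    (* For c = 0 the quadratic is affine in s, and this s gives it the value -1. *)
    specialize (H (- (a + 1) / (2 * b))). rewrite Hc0 in H.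
    replace (a + 2 * (- (a + 1) / (2 * b)) * b + _) with (-1) in H by (field; lra).
    lra.
  - specialize (H (- b / c)).
    replace (a + _ + _) with ((a * c - b ^ 2) / c) in H by (field; lra).
    assert (0 <= (a * c - b ^ 2) / c * c) by nra.
    replace ((a * c - b ^ 2) / c * c) with (a * c - b ^ 2) in * by (field; lra). lra.
Qed.

Definition indic (b : bool) : R := if b then 1 else 0.

(** * Rooted trees and path matrices *)

Section Tree.
Context (N : nat) (sigma : nat -> nat) (Htree : is_radial_tree N sigma).

Notation up m i := (Nat.iter m (par sigma) i).
Notation Anc := (anc N sigma).

Lemma par_0 : par sigma 0 = 0%nat.
Proof. reflexivity. Qed.

Lemma par_pos i : (1 <= i)%nat -> par sigma i = sigma i.
Proof. unfold par. destruct (Nat.eqb_spec i 0); [lia|easy]. Qed.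

Lemma iter_par_0 m : up m 0%nat = 0%nat.
Proof. induction m as [|m IH]; [easy|]. simpl. now rewrite IH. Qed.

Lemma iter_par_le m i : (i <= N)%nat -> (up m i <= N)%nat.
Proof.
  intros Hi. induction m as [|m IH]; [easy|]. simpl.
  destruct (Nat.eq_dec (up m i) 0) as [->|Hne]; [rewrite par_0; lia|].
  rewrite par_pos by lia. apply Htree; lia.
Qed.

(** Induction on the number of steps to the root, since labels need not increase along a path. *)
Lemma tree_ind (P : nat -> Prop) :
  P 0%nat -> (forall i, (1 <= i <= N)%nat -> P (sigma i) -> P i) ->
  forall i, (i <= N)%nat -> P i.
Proof.
  intros H0 HS.
  assert (H : forall m i, (i <= N)%nat -> up m i = 0%nat -> P i).
  { induction m as [|m IH]; intros i Hi Hm; [now simpl in Hm; subst|].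
    destruct (Nat.eq_dec i 0) as [->|Hne]; [easy|].
    rewrite Nat.iter_succ_r, par_pos in Hm by lia.
    apply HS; [lia|]. apply IH; [apply Htree; lia|easy]. }
  intros i Hi. destruct (Nat.eq_dec i 0) as [->|Hne]; [easy|].
  destruct (Htree i) as [_ [m Hm]]; [lia|]. now apply (H m).
Qed.

Lemma iter_par_root i : (i <= N)%nat -> exists m, up m i = 0%nat.
Proof.
  intros Hi. destruct (Nat.eq_dec i 0) as [->|]; [now exists 0%nat|].
  apply Htree; lia.
Qed.

(** A loop of length k can be run m times. The m * k steps return to i, yet m of them already reach
    the root, where [par] stays. *)
Lemma acyclic k i : (i <= N)%nat -> (1 <= k)%nat -> up k i = i -> i = 0%nat.
Proof.
  intros Hi Hk Hc. destruct (iter_par_root i Hi) as [m Hm].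
  assert (H : forall n, up (n * k) i = i).
  { induction n as [|n IH]; [easy|]. simpl. now rewrite Nat.iter_add, IH. }
  rewrite <- (H m). replace (m * k)%nat with ((m * k - m) + m)%nat by nia.
  rewrite Nat.iter_add, Hm. apply iter_par_0.
Qed.

(** Pigeonhole: until the root is reached the iterates are distinct nodes of 1..N. This makes the
    bounded search in [anc] exhaustive. *)
Lemma depth_lt m i : (i <= N)%nat -> up m i <> 0%nat -> (m < N)%nat.
Proof.
  intros Hi Hm.
  assert (Hpos : forall a, (a <= m)%nat -> up a i <> 0%nat).
  { intros a Ha H0. apply Hm. replace m with ((m - a) + a)%nat by lia.
    rewrite Nat.iter_add, H0. apply iter_par_0. }
  assert (Hinj : forall a b, (a < b <= m)%nat -> up a i <> up b i).
  { intros a b Hab E. apply (Hpos a); [lia|].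
    apply (acyclic (b - a)); [now apply iter_par_le|lia|].
    rewrite <- Nat.iter_add. now replace (b - a + a)%nat with b by lia. }
  assert (Hnd : NoDup (map (fun a => up a i) (seq 0 (S m)))).
  { apply NoDup_map_NoDup_ForallPairs; [|apply seq_NoDup].
    intros a b Ha Hb E. apply in_seq in Ha, Hb.
    destruct (Nat.lt_trichotomy a b) as [H|[H|H]]; [|easy|].
    - exfalso. apply (Hinj a b); [lia|easy].
    - exfalso. apply (Hinj b a); [lia|easy]. }
  apply NoDup_incl_length with (l' := seq 1 N) in Hnd.
  - rewrite length_map, !length_seq in Hnd. lia.
  - intros y Hy. apply in_map_iff in Hy. destruct Hy as [a [<- Ha]].
    apply in_seq in Ha. apply in_seq. pose proof (Hpos a). pose proof (iter_par_le a i Hi). lia.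
Qed.

Lemma anc_iff k i : (i <= N)%nat ->
  Anc k i = true <-> k <> 0%nat /\ exists m, up m i = k.
Proof.
  intros Hi. unfold anc. rewrite andb_true_iff, negb_true_iff, Nat.eqb_neq, existsb_exists.
  split; intros [Hk [m Hm]]; split; [easy| |easy|].
  - exists m. now apply Nat.eqb_eq.
  - exists m. rewrite Hm, Nat.eqb_refl. split; [|easy]. apply in_seq.
    enough (m < N)%nat by lia. apply depth_lt with (i := i); [easy|]. now rewrite Hm.
Qed.

Lemma anc_0_r k : Anc k 0 = false.
Proof.
  apply not_true_iff_false. rewrite anc_iff by lia. intros [Hk [m Hm]].
  rewrite iter_par_0 in Hm. lia.
Qed.

Lemma sigma_le i : (1 <= i <= N)%nat -> (sigma i <= N)%nat.
Proof. intros Hi. now apply Htree. Qed.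

Lemma anc_step k i : (1 <= i <= N)%nat ->
  Anc k i = (Nat.eqb k i || Anc k (sigma i))%bool.
Proof.
  intros Hi. pose proof (sigma_le i Hi). apply eq_true_iff_eq.
  rewrite orb_true_iff, !anc_iff, Nat.eqb_eq by lia. split.
  - intros [Hk [[|m] Hm]]; [now left|].
    right. split; [easy|]. exists m. now rewrite Nat.iter_succ_r, par_pos in Hm by lia.
  - intros [->|[Hk [m Hm]]]; [split; [lia|now exists 0%nat]|].
    split; [easy|]. exists (S m). now rewrite Nat.iter_succ_r, par_pos by lia.
Qed.

Lemma anc_refl i : (1 <= i <= N)%nat -> Anc i i = true.
Proof. intros Hi. now rewrite anc_step, Nat.eqb_refl by easy. Qed.

Lemma anc_parent_false i : (1 <= i <= N)%nat -> Anc i (sigma i) = false.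
Proof.
  intros Hi. apply not_true_iff_false. rewrite anc_iff by now apply sigma_le.
  intros [Hk [m Hm]]. apply Hk. apply (acyclic (S m)); [lia|lia|].
  now rewrite Nat.iter_succ_r, par_pos by lia.
Qed.

Lemma anc_trans m i k : (i <= N)%nat -> (k <= N)%nat ->
  Anc m i = true -> Anc i k = true -> Anc m k = true.
Proof.
  intros Hi. revert k. apply (tree_ind (fun k => Anc m i = true -> Anc i k = true -> Anc m k = true)).
  - now rewrite (anc_0_r i).
  - intros k Hk IH Hmi. rewrite !(anc_step _ k) by easy. rewrite !orb_true_iff.
    intros [E|H]; [apply Nat.eqb_eq in E; subst i|right; now apply IH].
    rewrite (anc_step m k), orb_true_iff in Hmi by easy. easy.
Qed.

Lemma ind_anc_step k i : (1 <= i <= N)%nat ->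
  indic (Anc k i) = indic (Nat.eqb k i) + indic (Anc k (sigma i)).
Proof.
  intros Hi. rewrite anc_step by easy. destruct (Nat.eqb_spec k i) as [->|]; simpl; [|lra].
  rewrite anc_parent_false by easy. simpl. lra.
Qed.

(** A subtree is its top node and the disjoint subtrees of the children. Indicators turn this into a
    linear identity between message coefficients. The induction moves k, with i fixed. *)
Lemma ind_subtree i k : (1 <= i <= N)%nat -> (k <= N)%nat ->
  indic (Anc i k) = indic (Nat.eqb i k) + sumC N sigma i (fun j => indic (Anc j k)).
Proof.
  intros Hi. revert k. apply tree_ind.
  - rewrite anc_0_r. destruct (Nat.eqb_spec i 0); [lia|].
    unfold sumC. rewrite (sumN_ext _ _ (fun _ => 0)), sumN_zero; [simpl; lra|].
    intros j Hj. rewrite anc_0_r. now destruct (sigma j =? i)%nat.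
  - intros k Hk IH. rewrite ind_anc_step, IH by easy. f_equal.
    (* Passing from [sigma k] to k adds only the term j = k to the sum over children, and only if k
       is a child of i. *)
    unfold sumC. rewrite (sumN_ext _ (fun j => if (sigma j =? i)%nat then indic (Anc j k) else 0)
      (fun j => (if (j =? k)%nat then indic (i =? sigma j)%nat else 0)
        + (if (sigma j =? i)%nat then indic (Anc j (sigma k)) else 0))).
    + rewrite sumN_plus. f_equal. now rewrite (sumN_single N (fun j => indic (i =? sigma j)%nat)).
    + intros j Hj. rewrite ind_anc_step by easy. rewrite (Nat.eqb_sym i).
      destruct (sigma j =? i)%nat, (j =? k)%nat; simpl; lra.
Qed.

Lemma anc_child i j k : (1 <= j <= N)%nat -> (k <= N)%nat -> sigma j = i -> (1 <= i)%nat ->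
  Anc j k = true -> Anc i k = true.
Proof.
  intros Hj Hk Hs Hi. apply anc_trans; [lia|easy|].
  rewrite anc_step, Hs, anc_refl by (try easy; pose proof (sigma_le j Hj); lia). apply orb_true_r.
Qed.

(** * Entries and quadratic form of a path matrix *)

Section PathMatrix.
Context (r : nat -> R) (Hr : forall k, (1 <= k <= N)%nat -> 0 <= r k).
Notation Rm := (pathmat N sigma r).

Lemma pathmat_ge0 i j : 0 <= Rm i j.
Proof.
  unfold pathmat. apply Rmult_le_pos; [lra|]. apply sumN_ge0; intros k Hk.
  destruct (_ && _)%bool; [now apply Hr|lra].
Qed.

Lemma pathmat_sym i j : Rm i j = Rm j i.
Proof.
  unfold pathmat. f_equal. apply sumN_ext. intros. now rewrite andb_comm.
Qed.

Lemma pathmat_0_l k : Rm 0%nat k = 0.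
Proof.
  unfold pathmat. rewrite (sumN_ext _ _ (fun _ => 0)), sumN_zero; [lra|].
  intros m _. now rewrite anc_0_r.
Qed.

(** The edge above j is not on the path to k. With [pathmat_anc] this is the recursion by which
    downward messages build row j from the row of the parent. *)
Lemma pathmat_outside j k : (1 <= j <= N)%nat -> Anc j k = false ->
  Rm j k = Rm (sigma j) k.
Proof.
  intros Hj Hjk. unfold pathmat. f_equal. apply sumN_ext. intros m Hm.
  rewrite anc_step by easy. destruct (Nat.eqb_spec m j) as [->|]; [|easy].
  rewrite Hjk, !andb_false_r. easy.
Qed.

Lemma pathmat_anc i k : (1 <= i <= N)%nat -> (k <= N)%nat -> Anc i k = true ->
  Rm i k = Rm i i.
Proof.
  intros Hi Hk Hik. unfold pathmat. f_equal. apply sumN_ext. intros m Hm.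
  destruct (Anc m i) eqn:E; [|easy]. rewrite (anc_trans m i k); [easy|lia|easy|easy|easy].
Qed.

(** Gram form: the matrix is a sum over edges k of 2 r_k times the rank-one matrix of the indicator
    of the subtree below k. *)
Lemma pathmat_quad x :
  sumN N (fun i => x i * matvec N Rm x i)
  = 2 * sumN N (fun k => r k * sumN N (fun i => indic (Anc k i) * x i) ^ 2).
Proof.
  unfold matvec, pathmat.
  rewrite (sumN_ext _ _ (fun i => sumN N (fun j => sumN N (fun k =>
     2 * (r k * (indic (Anc k i) * x i) * (indic (Anc k j) * x j)))))).
  2:{ intros i Hi. rewrite <- sumN_scal. apply sumN_ext; intros j Hj.
      rewrite (Rmult_comm 2), Rmult_assoc, <- sumN_scalr.
      rewrite <- sumN_scal. apply sumN_ext; intros k Hk.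
      unfold indic. destruct (Anc k i), (Anc k j); simpl; ring. }
  rewrite (sumN_ext _ _ (fun i => sumN N (fun k => sumN N (fun j =>
     2 * (r k * (indic (Anc k i) * x i) * (indic (Anc k j) * x j))))))
    by (intros; apply sumN_swap).
  rewrite sumN_swap, <- sumN_scal. apply sumN_ext; intros k Hk.
  set (s := sumN N (fun i => indic (Anc k i) * x i)).
  rewrite (sumN_ext _ _ (fun i => (2 * r k * s) * (indic (Anc k i) * x i))).
  - rewrite sumN_scal. fold s. ring.
  - intros i Hi. rewrite !sumN_scal. fold s. ring.
Qed.

Lemma pathmat_quad_diag x :
  sumN N (fun i => x i * matvec N Rm x i) <= INR N * sumN N (fun i => Rm i i * x i ^ 2).
Proof.
  rewrite pathmat_quad.
  assert (E : sumN N (fun i => Rm i i * x i ^ 2)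
     = 2 * sumN N (fun k => r k * sumN N (fun i => (indic (Anc k i) * x i) ^ 2))).
  { unfold pathmat.
    rewrite (sumN_ext _ _ (fun i => sumN N (fun k => 2 * (r k * (indic (Anc k i) * x i) ^ 2)))).
    - rewrite sumN_swap, <- sumN_scal. apply sumN_ext; intros. now rewrite !sumN_scal.
    - intros i Hi. rewrite Rmult_assoc, <- sumN_scalr, <- sumN_scal.
      apply sumN_ext; intros k Hk. unfold indic. destruct (Anc k i); simpl; ring. }
  rewrite E, <- !sumN_scal. apply sumN_le; intros k Hk.
  (* Cauchy-Schwarz against the constant vector bounds each squared subtree sum; its squared norm is
     the factor N. *)
  pose proof (sumN_cauchy_schwarz N (fun _ => 1) (fun i => indic (Anc k i) * x i)) as H.
  rewrite (sumN_ext _ (fun i => 1 * _) (fun i => indic (Anc k i) * x i)) in H by (intros; ring).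
  rewrite (sumN_ext _ (fun i => 1 ^ 2) (fun i => 1)) in H by (intros; ring).
  rewrite sumN_const in H. specialize (Hr k Hk). nra.
Qed.

End PathMatrix.

(** * Tree distance along one edge *)

Lemma length_filter_flip (f g : nat -> bool) j l : NoDup l -> In j l ->
  f j = true -> g j = false -> (forall k, In k l -> k <> j -> f k = g k) ->
  length (filter f l) = S (length (filter g l)).
Proof.
  induction l as [|a l IH]; intros Hnd Hin Hf Hg Hfg; [easy|].
  inversion Hnd as [|? ? Ha Hnd']; subst. simpl.
  destruct (Nat.eq_dec a j) as [->|Hne].
  - rewrite Hf, Hg. simpl. do 2 f_equal. apply filter_ext_in.
    intros k Hk. apply Hfg; [now right|]. now intros ->.
  - destruct Hin as [|Hin]; [easy|].
    rewrite (Hfg a) by (simpl; auto). destruct (g a); simpl; rewrite IH; auto; intros; apply Hfg; simpl; auto.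
Qed.

(** The paths to j and to its parent differ in the edge above j alone. That edge is on the path to k
    when k lies below j, so moving up puts it into the symmetric difference; in [dist_outside]
    moving up takes it out. *)
Lemma dist_inside j k : (1 <= j <= N)%nat -> (k <= N)%nat -> Anc j k = true ->
  Defs.dist N sigma (sigma j) k = S (Defs.dist N sigma j k).
Proof.
  intros Hj Hk Hjk. unfold Defs.dist. apply (length_filter_flip _ _ j).
  - apply seq_NoDup.
  - apply in_seq; lia.
  - now rewrite anc_parent_false, Hjk.
  - now rewrite anc_refl, Hjk.
  - intros m _ Hm. rewrite (anc_step m j) by easy.
    now destruct (Nat.eqb_spec m j).
Qed.

Lemma dist_outside j k : (1 <= j <= N)%nat -> (k <= N)%nat -> Anc j k = false ->
  Defs.dist N sigma j k = S (Defs.dist N sigma (sigma j) k).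
Proof.
  intros Hj Hk Hjk. unfold Defs.dist. apply (length_filter_flip _ _ j).
  - apply seq_NoDup.
  - apply in_seq; lia.
  - now rewrite anc_refl, Hjk.
  - now rewrite anc_parent_false, Hjk.
  - intros m _ Hm. rewrite (anc_step m j) by easy.
    now destruct (Nat.eqb_spec m j).
Qed.

Lemma dist_diag i : Defs.dist N sigma i i = 0%nat.
Proof.
  unfold Defs.dist. rewrite (filter_ext _ (fun _ => false)) by (intros; apply xorb_nilpotent).
  now induction (seq 1 N).
Qed.

Lemma dist_le_diam i j : (1 <= i <= N)%nat -> (1 <= j <= N)%nat ->
  (Defs.dist N sigma i j <= diam N sigma)%nat.
Proof.
  intros Hi Hj. unfold diam.
  assert (H : In (Defs.dist N sigma i j)
    (flat_map (fun i => map (fun j => Defs.dist N sigma i j) (seq 1 N)) (seq 1 N))).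
  { apply in_flat_map. exists i. split; [apply in_seq; lia|].
    apply in_map. apply in_seq; lia. }
  induction (flat_map _ _) as [|a l IH]; [easy|]. simpl.
  destruct H as [->|H]; [lia|]. specialize (IH H). lia.
Qed.

End Tree.

(** * Delayed message passing *)

Fixpoint psum (f : nat -> R) (t : nat) : R :=
  match t with O => 0 | S s => psum f s + f s end.

(* Truncated subtraction: times before 0 contribute nothing. *)
Definition past (f : nat -> R) (t n : nat) : R := psum f t - psum f (t - n).

Lemma psum_mono f u t : (forall s, 0 <= f s) -> (u <= t)%nat -> psum f u <= psum f t.
Proof.
  intros Hf H. induction H as [|t H IH]; [lra|]. simpl. specialize (Hf t). lra.
Qed.

Lemma psum_le f g t : (forall s, f s <= g s) -> psum f t <= psum g t.
Proof.
  intros H. induction t as [|t IH]; simpl; [lra|]. specialize (H t). lra.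
Qed.

Lemma past_ge0 f t n : (forall s, 0 <= f s) -> 0 <= past f t n.
Proof.
  intros H. unfold past. assert (psum f (t - n) <= psum f t) by (apply psum_mono; [easy|lia]). lra.
Qed.

Lemma past_mono f t n n' : (forall s, 0 <= f s) -> (n <= n')%nat -> past f t n <= past f t n'.
Proof.
  intros H Hn. unfold past.
  assert (psum f (t - n') <= psum f (t - n)) by (apply psum_mono; [easy|lia]). lra.
Qed.

Lemma past_0 f t : past f t 0 = 0.
Proof. unfold past. rewrite Nat.sub_0_r. lra. Qed.

(** A message dated before 0 reads 0, which is also the value at time 0, so the default counts as a
    message of staleness at most [tau]. *)
Lemma delayed_eq m t tau : m 0%nat = 0 ->
  exists u, (u <= t <= u + tau)%nat /\ delayed m t tau = m u.
Proof.
  intros H0. unfold delayed. destruct (Nat.leb_spec tau t).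
  - exists (t - tau)%nat. split; [lia|easy].
  - exists 0%nat. split; [lia|easy].
Qed.

(** * Linear combinations of stale multipliers *)

Section Approx.
Context (N : nat) (lam : nat -> nat -> R).
Hypothesis lam0 : forall k, (1 <= k <= N)%nat -> lam 0%nat k = 0.

Definition incr (k s : nat) : R := Rabs (lam (S s) k - lam s k).

Lemma incr_ge0 k s : 0 <= incr k s.
Proof. apply Rabs_pos. Qed.

(* Says that y is sum_k c_k lam_k(t_k) for stale times t_k in [t - n_k, t], in a
   form that does not name the t_k and is stable under sums and time shifts. *)
Definition approx (t : nat) (y : R) (c : nat -> R) (n : nat -> nat) : Prop :=
  Rabs (y - sumN N (fun k => c k * lam t k)) <= sumN N (fun k => c k * past (incr k) t (n k)).

Lemma incr_tele k u t : (u <= t)%nat ->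
  Rabs (lam t k - lam u k) <= psum (incr k) t - psum (incr k) u.
Proof.
  intros H. induction H as [|t H IH].
  - rewrite Rminus_diag, Rabs_R0. lra.
  - simpl. unfold incr at 2.
    replace (lam (S t) k - lam u k) with ((lam (S t) k - lam t k) + (lam t k - lam u k)) by ring.
    eapply Rle_trans; [apply Rabs_triang|]. lra.
Qed.

(** Ageing adds: the increments between u and t pay for the change of [lam], those before u for the
    older error. *)
Lemma past_shift k u t n m : (u <= t <= u + m)%nat ->
  Rabs (lam t k - lam u k) + past (incr k) u n <= past (incr k) t (n + m).
Proof.
  intros H. unfold past.
  assert (psum (incr k) (t - (n + m)) <= psum (incr k) (u - n))
    by (apply psum_mono; [apply incr_ge0|lia]).
  pose proof (incr_tele k u t ltac:(lia)). lra.
Qed.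

Lemma approx_shift u t y c n m :
  (forall k, (1 <= k <= N)%nat -> 0 <= c k) -> (u <= t <= u + m)%nat ->
  approx u y c n -> approx t y c (fun k => (n k + m)%nat).
Proof.
  unfold approx. intros Hc Hu H.
  replace (y - sumN N (fun k => c k * lam t k)) with
    ((y - sumN N (fun k => c k * lam u k)) - sumN N (fun k => c k * (lam t k - lam u k))).
  2:{ rewrite (sumN_ext _ (fun k => c k * (_ - _)) (fun k => c k * lam t k - c k * lam u k))
        by (intros; ring). rewrite sumN_minus. ring. }
  eapply Rle_trans; [apply Rabs_triang|]. rewrite Rabs_Ropp.
  assert (Rabs (sumN N (fun k => c k * (lam t k - lam u k)))
     <= sumN N (fun k => c k * Rabs (lam t k - lam u k))).
  { eapply Rle_trans; [apply sumN_abs|]. apply sumN_le; intros k Hk.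
    rewrite Rabs_mult, (Rabs_pos_eq (c k)) by auto. lra. }
  eapply Rle_trans; [apply Rplus_le_compat; eassumption|].
  rewrite <- sumN_plus. apply sumN_le; intros k Hk.
  pose proof (past_shift k u t (n k) m Hu). specialize (Hc k Hk). nra.
Qed.

(** The staleness has to be respected only where the coefficient is nonzero. This later disposes of
    truncated subtractions at distance 0. *)
Lemma approx_weaken t y c c' n n' :
  (forall k, (1 <= k <= N)%nat -> 0 <= c k) ->
  (forall k, (1 <= k <= N)%nat -> c k = c' k) ->
  (forall k, (1 <= k <= N)%nat -> c k <> 0 -> (n k <= n' k)%nat) ->
  approx t y c n -> approx t y c' n'.
Proof.
  unfold approx. intros Hc Hcc Hn H.
  rewrite <- (sumN_ext N (fun k => c k * lam t k)) by (intros; now rewrite Hcc).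
  eapply Rle_trans; [apply H|]. apply sumN_le; intros k Hk. rewrite <- Hcc by easy.
  destruct (Req_dec (c k) 0) as [->|Hne]; [lra|].
  apply Rmult_le_compat_l; [auto|]. apply past_mono; [apply incr_ge0|auto].
Qed.

Lemma approx_mono t y c n n' :
  (forall k, (1 <= k <= N)%nat -> 0 <= c k) ->
  (forall k, (1 <= k <= N)%nat -> c k <> 0 -> (n k <= n' k)%nat) ->
  approx t y c n -> approx t y c n'.
Proof. intros Hc. now apply approx_weaken. Qed.

Lemma approx_0 t n : approx t 0 (fun _ => 0) n.
Proof.
  unfold approx. rewrite !(sumN_ext _ (fun k => 0 * _) (fun _ => 0)) by (intros; ring).
  rewrite sumN_zero, Rminus_0_r, Rabs_R0. lra.
Qed.

Lemma approx_init c n : (forall k, (1 <= k <= N)%nat -> 0 <= c k) -> approx 0 0 c n.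
Proof.
  intros Hc. unfold approx. rewrite (sumN_ext _ _ (fun _ => 0)), sumN_zero.
  - rewrite Rminus_0_r, Rabs_R0. apply sumN_ge0; intros k Hk.
    apply Rmult_le_pos; [auto|apply past_ge0, incr_ge0].
  - intros k Hk. rewrite lam0 by easy. ring.
Qed.

Lemma approx_self t i n : (1 <= i <= N)%nat ->
  approx t (lam t i) (fun k => indic (Nat.eqb i k)) n.
Proof.
  intros Hi. unfold approx.
  rewrite (sumN_ext _ _ (fun k => if Nat.eqb k i then lam t k else 0)).
  - rewrite sumN_single, Rminus_diag, Rabs_R0 by easy. apply sumN_ge0; intros k Hk.
    apply Rmult_le_pos; [destruct (Nat.eqb _ _); simpl; lra|apply past_ge0, incr_ge0].
  - intros k Hk. rewrite Nat.eqb_sym. destruct (Nat.eqb k i); simpl; ring.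
Qed.

Lemma approx_plus t y y' c c' n :
  approx t y c n -> approx t y' c' n -> approx t (y + y') (fun k => c k + c' k) n.
Proof.
  unfold approx. intros H H'.
  rewrite (sumN_ext _ _ (fun k => c k * lam t k + c' k * lam t k)) by (intros; ring).
  rewrite (sumN_ext _ (fun k => (c k + c' k) * past _ _ _)
     (fun k => c k * past (incr k) t (n k) + c' k * past (incr k) t (n k))) by (intros; ring).
  rewrite !sumN_plus.
  replace (y + y' - _) with ((y - sumN N (fun k => c k * lam t k)) +
     (y' - sumN N (fun k => c' k * lam t k))) by ring.
  eapply Rle_trans; [apply Rabs_triang|lra].
Qed.

Lemma approx_scal t a y c n : 0 <= a ->
  approx t y c n -> approx t (a * y) (fun k => a * c k) n.
Proof.
  unfold approx. intros Ha H.
  rewrite (sumN_ext _ _ (fun k => a * (c k * lam t k))) by (intros; ring).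
  rewrite (sumN_ext _ (fun k => a * c k * past _ _ _)
     (fun k => a * (c k * past (incr k) t (n k)))) by (intros; ring).
  rewrite !sumN_scal, <- Rmult_minus_distr_l, Rabs_mult, (Rabs_pos_eq a) by easy.
  now apply Rmult_le_compat_l.
Qed.

Lemma approx_sum t M f c n :
  (forall j, (1 <= j <= M)%nat -> approx t (f j) (c j) n) ->
  approx t (sumN M f) (fun k => sumN M (fun j => c j k)) n.
Proof.
  induction M as [|M IH]; intros H; [apply approx_0|].
  rewrite sumN_S.
  pose proof (approx_plus t _ _ _ _ n (IH ltac:(intros; apply H; lia)) (H (S M) ltac:(lia))) as Hs.
  unfold approx in *.
  rewrite (sumN_ext _ (fun k => sumN (S M) _ * lam t k)
    (fun k => (sumN M (fun j => c j k) + c (S M) k) * lam t k)) by (intros; now rewrite sumN_S).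
  rewrite (sumN_ext _ (fun k => sumN (S M) _ * past _ _ _)
    (fun k => (sumN M (fun j => c j k) + c (S M) k) * past (incr k) t (n k)))
    by (intros; now rewrite sumN_S).
  exact Hs.
Qed.

End Approx.

Lemma indic_ge0 b : 0 <= indic b.
Proof. destruct b; simpl; lra. Qed.

(** * Coefficients and staleness of the messages *)

Section Messages.
Context (N : nat) (sigma : nat -> nat) (Htree : is_radial_tree N sigma).
Context (taumax : nat) (lam alpha halpha : nat -> nat -> R).
Hypothesis lam0 : forall k, (1 <= k <= N)%nat -> lam 0%nat k = 0.
Hypothesis alpha0 : forall i, (1 <= i <= N)%nat -> alpha 0%nat i = 0.
Hypothesis halpha_eq : forall t j, (1 <= j <= N)%nat -> sigma j <> 0%nat ->
  exists u, (u <= t <= u + taumax)%nat /\ halpha t j = alpha u j.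
Hypothesis alpha_S : forall t i, (1 <= i <= N)%nat ->
  alpha (S t) i = lam (S t) i + sumC N sigma i (halpha t).

Notation Anc := (anc N sigma).
Notation dist := (Defs.dist N sigma).
Notation approx := (approx N lam).

(** The upward message of i stands for the sum of the multipliers in the subtree of i. *)
Definition alpha_spec t := forall i, (1 <= i <= N)%nat ->
  approx t (alpha t i) (fun k => indic (Anc i k)) (fun k => (taumax + 1) * dist i k)%nat.

Lemma halpha_approx t j : (forall u, (u <= t)%nat -> alpha_spec u) ->
  (1 <= j <= N)%nat -> sigma j <> 0%nat ->
  approx t (halpha t j) (fun k => indic (Anc j k))
    (fun k => (taumax + 1) * dist j k + taumax)%nat.
Proof.
  intros H Hj Hs. destruct (halpha_eq t j Hj Hs) as [u [Hu ->]].
  apply approx_shift with (u := u); [intros; apply indic_ge0|easy|]. apply H; [lia|easy].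
Qed.

(** On arrival the staleness is (taumax + 1) (dist j k + 1) - 1; the step left over pays for the
    update from t to t + 1. The predicate [P] selects all children, or all but the recipient of a
    downward message. *)
Lemma children_approx t i (P : nat -> bool) : (forall u, (u <= t)%nat -> alpha_spec u) ->
  (1 <= i <= N)%nat ->
  approx t (sumN N (fun j => if (sigma j =? i)%nat && P j then halpha t j else 0))
    (fun k => sumN N (fun j => if (sigma j =? i)%nat && P j then indic (Anc j k) else 0))
    (fun k => (taumax + 1) * dist i k - 1)%nat.
Proof.
  intros H Hi. apply approx_sum. intros j Hj.
  destruct (Nat.eqb_spec (sigma j) i) as [Hs|]; [|apply approx_0].
  destruct (P j); [|apply approx_0]. cbn [andb].
  eapply approx_weaken; [..|apply halpha_approx; [apply H|apply Hj|lia]]; cbn beta.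
  - intros; apply indic_ge0.
  - easy.
  - intros k Hk Hne. destruct (Anc j k) eqn:E; [|now elim Hne].
    rewrite <- Hs, (dist_inside N sigma Htree j k) by (easy || lia). lia.
Qed.

Lemma sumC_true i f :
  sumC N sigma i f = sumN N (fun j => if (sigma j =? i)%nat && true then f j else 0).
Proof. apply sumN_ext. intros. now rewrite andb_true_r. Qed.

Lemma subtree_coef_ge0 i (P : nat -> bool) k :
  0 <= sumN N (fun j => if (sigma j =? i)%nat && P j then indic (Anc j k) else 0).
Proof.
  apply sumN_ge0; intros j _. destruct (_ && _)%bool; [apply indic_ge0|lra].
Qed.

Lemma own_children_approx t i (P : nat -> bool) : (forall u, (u <= t)%nat -> alpha_spec u) ->
  (1 <= i <= N)%nat ->
  approx (S t) (lam (S t) i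
      + sumN N (fun j => if (sigma j =? i)%nat && P j then halpha t j else 0))
    (fun k => indic (Nat.eqb i k)
      + sumN N (fun j => if (sigma j =? i)%nat && P j then indic (Anc j k) else 0))
    (fun k => (taumax + 1) * dist i k)%nat.
Proof.
  intros H Hi. apply approx_plus; [now apply approx_self|].
  eapply approx_weaken; [..|apply approx_shift with (u := t) (m := 1%nat); [|lia|now apply children_approx]];
    cbn beta.
  - intros; apply subtree_coef_ge0.
  - easy.
  (* At distance 0 the subtraction is truncated and leaves no spare step, but no subtree of a child
     contains such a k, so its coefficient is 0. *)
  - intros k Hk Hne. destruct (Nat.eq_dec (dist i k) 0) as [E|]; [|nia].
    exfalso. apply Hne. rewrite (sumN_ext _ _ (fun _ => 0)); [apply sumN_zero|].
    intros j Hj. destruct (Nat.eqb_spec (sigma j) i) as [Hs|]; [|easy].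
    destruct (P j); [|easy]. destruct (Anc j k) eqn:Ea; [|easy]. exfalso.
    rewrite <- Hs, (dist_inside N sigma Htree j k) in E by (easy || lia). lia.
  - intros; apply subtree_coef_ge0.
Qed.

Lemma alpha_approx t : alpha_spec t.
Proof.
  induction t as [t IH] using lt_wf_ind. destruct t as [|t].
  - intros i Hi. rewrite alpha0 by easy. apply approx_init; [easy|]. intros; apply indic_ge0.
  - intros i Hi. rewrite alpha_S, sumC_true by easy.
    eapply approx_weaken; [..|apply own_children_approx; [intros u Hu; apply IH; lia|easy]]; cbn beta.
    + intros. pose proof (subtree_coef_ge0 i (fun _ => true) k).
      pose proof (indic_ge0 (i =? k)%nat). simpl in *. lra.
    + intros k Hk. rewrite (ind_subtree N sigma Htree i k) by (easy || lia). now rewrite sumC_true.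
    + easy.
Qed.

Section Beta.
Context (r : nat -> R) (Hr : forall k, (1 <= k <= N)%nat -> 0 <= r k).
Context (beta hbeta z : nat -> nat -> R).
Notation Rm := (pathmat N sigma r).
Hypothesis beta0 : forall i, (1 <= i <= N)%nat -> beta 0%nat i = 0.
Hypothesis hbeta_root : forall i t, (1 <= i <= N)%nat -> sigma i = 0%nat -> hbeta t i = 0.
Hypothesis hbeta_eq : forall t j, (1 <= j <= N)%nat -> sigma j <> 0%nat ->
  exists u, (u <= t <= u + taumax)%nat /\ hbeta t j = beta u j.
Hypothesis beta_S : forall t j, (1 <= j <= N)%nat -> sigma j <> 0%nat ->
  beta (S t) j = Rm (sigma j) (sigma j) * (lam (S t) (sigma j) + sumC' N sigma (sigma j) j (halpha t))
    + hbeta t (sigma j).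
Hypothesis z_0 : forall i, (1 <= i <= N)%nat -> z 0%nat i = 0.
Hypothesis z_S : forall t i, (1 <= i <= N)%nat ->
  z (S t) i = Rm i i * (lam (S t) i + sumC N sigma i (halpha (S t))) + hbeta (S t) i.

(** The part of row j that cannot be learned from the subtree of j and must come down from the
    parent. *)
Definition outside j k := indic (negb (Anc j k)) * Rm j k.

Lemma outside_ge0 j k : 0 <= outside j k.
Proof. apply Rmult_le_pos; [apply indic_ge0|now apply pathmat_ge0]. Qed.

(** The message for j is composed at the parent, so its staleness is measured from [sigma j]; the
    hop down to j is charged on arrival. *)
Definition beta_spec t := forall j, (1 <= j <= N)%nat -> sigma j <> 0%nat ->
  approx t (beta t j) (outside j) (fun k => (taumax + 1) * dist (sigma j) k)%nat.

Lemma hbeta_approx t i : (forall u, (u <= t)%nat -> beta_spec u) -> (1 <= i <= N)%nat ->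
  approx t (hbeta t i) (outside i) (fun k => (taumax + 1) * dist i k - 1)%nat.
Proof.
  intros H Hi. destruct (Nat.eq_dec (sigma i) 0) as [Hs|Hs].
  - rewrite hbeta_root by easy. apply approx_weaken with (c := fun _ => 0) (n := fun _ => 0%nat);
      [..|apply approx_0].
    + intros; lra.
    (* Different branches at the root share no edge, so the coefficients vanish, in agreement with
       the message being 0. *)
    + intros k Hk. unfold outside. destruct (Anc i k) eqn:E; simpl; [ring|].
      rewrite (pathmat_outside N sigma Htree) by easy. rewrite Hs, (pathmat_0_l N sigma Htree). ring.
    + easy.
  - destruct (hbeta_eq t i Hi Hs) as [u [Hu ->]].
    eapply approx_weaken; [..|apply approx_shift with (u := u) (m := taumax); [|easy|apply H; [lia|easy|easy]]];
      cbn beta.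
    + intros; apply outside_ge0.
    + easy.
    + intros k Hk Hne. unfold outside in Hne. destruct (Anc i k) eqn:E; [simpl in Hne; lra|].
      rewrite (dist_outside N sigma Htree i k) by (easy || lia). lia.
    + intros; apply outside_ge0.
Qed.

(** Leaving out the recipient j removes exactly its own subtree, so nothing is echoed back to it. *)
Lemma sibling_coef j k : (1 <= j <= N)%nat -> (1 <= sigma j)%nat -> (1 <= k <= N)%nat ->
  indic (Nat.eqb (sigma j) k)
      + sumN N (fun l => if (sigma l =? sigma j)%nat && negb (l =? j)%nat then indic (Anc l k) else 0)
  = indic (Anc (sigma j) k) - indic (Anc j k).
Proof.
  intros Hj Hs Hk. pose proof (sigma_le N sigma Htree j Hj).
  rewrite (ind_subtree N sigma Htree (sigma j) k) by lia.
  rewrite <- (sumN_single N (fun l => indic (Anc l k)) j Hj). unfold sumC.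
  match goal with |- ?a + ?b = ?a + ?c - ?d => enough (b + d = c) by lra end.
  rewrite <- sumN_plus. apply sumN_ext. intros l Hl.
  destruct (Nat.eqb_spec l j) as [->|]; [rewrite Nat.eqb_refl|destruct (sigma l =? sigma j)%nat]; simpl; ring.
Qed.

Lemma beta_approx t : beta_spec t.
Proof.
  induction t as [t IH] using lt_wf_ind. destruct t as [|t]; intros j Hj Hs.
  - rewrite beta0 by easy. apply approx_init; [easy|]. intros; apply outside_ge0.
  - pose proof (sigma_le N sigma Htree j Hj) as Hle. rewrite beta_S by easy. unfold sumC'.
    eapply approx_weaken; [..|apply approx_plus;
      [apply approx_scal; [now apply pathmat_ge0|apply own_children_approx; [intros; apply alpha_approx|lia]]
      |eapply approx_mono; [..|apply approx_shift with (u := t) (m := 1%nat); [|lia|apply hbeta_approx; [intros; apply IH; lia|lia]]]]];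
      cbn beta.
    + intros k Hk. rewrite (sibling_coef j k) by lia.
      apply Rplus_le_le_0_compat; [|apply outside_ge0].
      apply Rmult_le_pos; [now apply pathmat_ge0|].
      destruct (Anc j k) eqn:E; [|pose proof (indic_ge0 (Anc (sigma j) k)); simpl; lra].
      rewrite (anc_child N sigma Htree (sigma j) j k) by (easy || lia). simpl; lra.
    (* Off the subtree of j, R_jk equals R_ik with i = sigma_j. It is R_ii if k lies below i and
       comes from [outside i] if not: the two summands of the update. *)
    + intros k Hk. rewrite (sibling_coef j k) by lia. unfold outside.
      destruct (Anc j k) eqn:E.
      * rewrite (anc_child N sigma Htree (sigma j) j k) by (easy || lia). simpl; ring.
      * rewrite (pathmat_outside N sigma Htree r j k) by easy.
        destruct (Anc (sigma j) k) eqn:E'; simpl; [|ring].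
        rewrite (pathmat_anc N sigma Htree r (sigma j) k) by (easy || lia). ring.
    + easy.
    + intros; apply outside_ge0.
    + intros k Hk Hne. destruct (Nat.eq_dec (dist (sigma j) k) 0) as [E|]; [|nia].
      exfalso. apply Hne. unfold outside. destruct (Anc (sigma j) k) eqn:E'; [simpl; ring|].
      rewrite (dist_outside N sigma Htree (sigma j) k) in E by (easy || lia). lia.
    + intros; apply outside_ge0.
Qed.

(** The subtree of i enters at rate R_ii through the upward messages, the rest of row i through the
    downward one. Both are read at the time of the price itself, so no update step is added. *)
Lemma z_approx t i : (1 <= i <= N)%nat ->
  approx t (z t i) (Rm i) (fun k => (taumax + 1) * dist i k)%nat.
Proof.
  intros Hi. destruct t as [|t].
  { rewrite z_0 by easy. apply approx_init; [easy|]. intros; now apply pathmat_ge0. }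
  rewrite z_S, sumC_true by easy.
  eapply approx_weaken with (n := fun k => ((taumax + 1) * dist i k)%nat);
   [..|apply approx_plus; [apply approx_scal; [now apply pathmat_ge0
      |apply approx_plus; [now apply approx_self
        |eapply approx_mono; [..|apply children_approx; [intros; apply alpha_approx|easy]]]]
    |eapply approx_mono; [..|apply hbeta_approx; [intros; apply beta_approx|easy]]]]; cbn beta.
  - intros k Hk. pose proof (subtree_coef_ge0 i (fun _ => true) k). pose proof (indic_ge0 (i =? k)%nat).
    apply Rplus_le_le_0_compat; [|apply outside_ge0].
    apply Rmult_le_pos; [now apply pathmat_ge0|]. simpl in *. lra.
  - intros k Hk. pose proof (ind_subtree N sigma Htree i k Hi ltac:(lia)) as E.
    rewrite sumC_true in E. simpl in *. rewrite <- E. unfold outside.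
    destruct (Anc i k) eqn:E'; simpl; [|ring].
    rewrite (pathmat_anc N sigma Htree r i k) by (easy || lia). ring.
  - easy.
  - intros; apply subtree_coef_ge0.
  - intros; lia.
  - intros; apply outside_ge0.
  - intros; lia.
Qed.

Lemma z_error t i : (1 <= i <= N)%nat ->
  Rabs (z t i - matvec N Rm (lam t) i)
  <= sumN N (fun k => (if Nat.eqb k i then 0 else Rm i k)
        * past (incr lam k) t ((taumax + 1) * diam N sigma)).
Proof.
  intros Hi. eapply Rle_trans; [apply (z_approx t i Hi)|].
  apply sumN_le. intros k Hk. pose proof (pathmat_ge0 N sigma r Hr i k).
  destruct (Nat.eqb_spec k i) as [->|].
  - rewrite dist_diag, Nat.mul_0_r, past_0. lra.
  - apply Rmult_le_compat_l; [easy|]. apply past_mono; [apply incr_ge0|].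
    apply Nat.mul_le_mono_l. now apply dist_le_diam.
Qed.

End Beta.
End Messages.

(** * Spectral bounds for the off-diagonal part *)

Definition sqnorm (N : nat) (x : nat -> R) : R := sumN N (fun i => x i ^ 2).

Definition offdiag (M : nat -> nat -> R) (i k : nat) : R := if Nat.eqb k i then 0 else M i k.

Lemma sqnorm_ge0 N x : 0 <= sqnorm N x.
Proof. apply sumN_ge0. intros. apply pow2_ge_0. Qed.

Lemma vnorm_sqnorm N x : vnorm N x = sqrt (sqnorm N x).
Proof. unfold vnorm, sqnorm. f_equal. apply sumN_ext. intros; ring. Qed.

Lemma sqnorm_scal N a x : sqnorm N (fun i => a * x i) = a ^ 2 * sqnorm N x.
Proof.
  unfold sqnorm. rewrite <- sumN_scal. apply sumN_ext. intros; ring.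
Qed.

Lemma sqnorm_eq0 N x i : (1 <= i <= N)%nat -> sqnorm N x = 0 -> x i = 0.
Proof.
  intros Hi H. assert (x i ^ 2 <= 0); [|nra]. rewrite <- H.
  apply (sumN_term_le N (fun i => x i ^ 2)); [easy|]. intros; apply pow2_ge_0.
Qed.

Lemma matvec_scal N M a x i : matvec N M (fun j => a * x j) i = a * matvec N M x i.
Proof. unfold matvec. rewrite <- sumN_scal. apply sumN_ext. intros; ring. Qed.

Lemma matvec_plus N M x y i :
  matvec N M (fun j => x j + y j) i = matvec N M x i + matvec N M y i.
Proof. unfold matvec. rewrite <- sumN_plus. apply sumN_ext. intros; ring. Qed.

Lemma matvec_minus N M x y i :
  matvec N M (fun j => x j - y j) i = matvec N M x i - matvec N M y i.
Proof. unfold matvec. rewrite <- sumN_minus. apply sumN_ext. intros; ring. Qed.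

Lemma matvec_ext N M x y i : (forall j, (1 <= j <= N)%nat -> x j = y j) ->
  matvec N M x i = matvec N M y i.
Proof. intros H. apply sumN_ext. intros j Hj. now rewrite H. Qed.

Lemma matvec_adjoint N M x y : (forall i j, M i j = M j i) ->
  sumN N (fun i => x i * matvec N M y i) = sumN N (fun i => matvec N M x i * y i).
Proof.
  intros HM. unfold matvec.
  rewrite (sumN_ext _ _ (fun i => sumN N (fun j => x i * (M i j * y j))))
    by (intros; now rewrite sumN_scal).
  rewrite sumN_swap. apply sumN_ext; intros j Hj. rewrite <- sumN_scalr.
  apply sumN_ext; intros i Hi. rewrite (HM i j). ring.
Qed.

Lemma matvec_offdiag N M x i : (1 <= i <= N)%nat ->
  matvec N (offdiag M) x i = matvec N M x i - M i i * x i.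
Proof.
  intros Hi. unfold matvec.
  rewrite <- (sumN_single N (fun k => M i k * x k) i Hi), <- sumN_minus.
  apply sumN_ext; intros k _. unfold offdiag. destruct (Nat.eqb k i); ring.
Qed.

Lemma spectral_norm_bound N M nM : is_spectral_norm N M nM ->
  0 <= nM /\ forall x, sqnorm N (matvec N M x) <= nM ^ 2 * sqnorm N x.
Proof.
  intros [Hub _].
  assert (Hv : forall x, sqnorm N x <= 1 -> sqrt (sqnorm N (matvec N M x)) <= nM).
  { intros x Hx. apply Hub. exists x. rewrite !vnorm_sqnorm. split; [|easy].
    rewrite <- sqrt_1. now apply sqrt_le_1_alt. }
  assert (Hn : 0 <= nM).
  { eapply Rle_trans; [|apply (Hv (fun _ => 0))]; [apply sqrt_pos|].
    unfold sqnorm. rewrite (sumN_ext _ _ (fun _ => 0)), sumN_zero by (intros; ring). lra. }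
  split; [easy|]. intros x. pose proof (sqnorm_ge0 N x) as Hx.
  destruct (Req_dec (sqnorm N x) 0) as [E|E].
  - rewrite E, Rmult_0_r. unfold sqnorm. rewrite (sumN_ext _ _ (fun _ => 0)), sumN_zero; [lra|].
    intros i Hi. rewrite (matvec_ext _ _ _ (fun j => 0 * x j)).
    + rewrite matvec_scal. ring.
    + intros j Hj. rewrite (sqnorm_eq0 N x j Hj E). ring.
  - set (s := / sqrt (sqnorm N x)).
    assert (Hs : s ^ 2 = / sqnorm N x).
    { unfold s. rewrite pow_inv, pow2_sqrt; easy. }
    specialize (Hv (fun i => s * x i)).
    rewrite sqnorm_scal, Hs in Hv.
    assert (H1 : sqnorm N (matvec N M (fun i => s * x i)) = s ^ 2 * sqnorm N (matvec N M x)).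
    { rewrite <- sqnorm_scal. apply sumN_ext. intros. now rewrite matvec_scal. }
    rewrite H1, Hs in Hv. pose proof (sqnorm_ge0 N (matvec N M x)) as Hm.
    assert (Hi : 0 < / sqnorm N x) by (apply Rinv_0_lt_compat; lra).
    assert (H2 : / sqnorm N x * sqnorm N (matvec N M x) <= nM ^ 2).
    { rewrite <- (pow2_sqrt (/ sqnorm N x * _)) by nra. apply pow_incr.
      split; [apply sqrt_pos|]. apply Hv. rewrite Rinv_l by easy. lra. }
    apply Rmult_le_compat_r with (r := sqnorm N x) in H2; [|easy].
    replace (/ sqnorm N x * sqnorm N (matvec N M x) * sqnorm N x)
      with (sqnorm N (matvec N M x)) in H2 by (now field). exact H2.
Qed.

Lemma quad_form_bound N M nM x : 0 <= nM ->
  (forall x, sqnorm N (matvec N M x) <= nM ^ 2 * sqnorm N x) ->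
  sumN N (fun i => x i * matvec N M x i) <= nM * sqnorm N x.
Proof.
  intros Hn H. pose proof (sqnorm_ge0 N x). pose proof (sqnorm_ge0 N (matvec N M x)). specialize (H x).
  pose proof (sumN_cauchy_schwarz N x (matvec N M x)) as Hcs. fold (sqnorm N x) (sqnorm N (matvec N M x)) in Hcs.
  apply Rsqr_incr_0_var; [|nra]. unfold Rsqr. nra.
Qed.

Section OffDiagonal.
Context (N : nat) (sigma : nat -> nat) (r : nat -> R) (nM : R).
Hypothesis Htree : is_radial_tree N sigma.
Hypothesis Hr : forall k, (1 <= k <= N)%nat -> 0 <= r k.
Hypothesis Hn : is_spectral_norm N (pathmat N sigma r) nM.
Notation Rm := (pathmat N sigma r).
Notation c := (1 - / INR N).

(* Cauchy-Schwarz on each path gives x^T R x <= N sum_i R_ii x_i^2, so the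
   diagonal carries at least a 1/N share of the quadratic form. *)
Lemma offdiag_quad_le x : (1 <= N)%nat ->
  sumN N (fun i => x i * matvec N (offdiag Rm) x i) <= c * nM * sqnorm N x.
Proof.
  intros HN.
  destruct (spectral_norm_bound N Rm nM Hn) as [Hn0 Hnb].
  assert (E : sumN N (fun i => x i * matvec N (offdiag Rm) x i)
     = sumN N (fun i => x i * matvec N Rm x i) - sumN N (fun i => Rm i i * x i ^ 2)).
  { rewrite <- sumN_minus. apply sumN_ext; intros i Hi. rewrite matvec_offdiag by easy. ring. }
  rewrite E. pose proof (pathmat_quad_diag N sigma r Hr x) as Hd.
  pose proof (quad_form_bound N Rm nM x Hn0 Hnb) as Hq.
  assert (HNr : 1 <= INR N) by (apply (le_INR 1); easy).
  assert (Hi : / INR N * INR N = 1) by (apply Rinv_l; lra).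
  assert (0 < / INR N) by (apply Rinv_0_lt_compat; lra).
  assert (/ INR N <= 1) by nra.
  assert (/ INR N * sumN N (fun i => x i * matvec N Rm x i) <= sumN N (fun i => Rm i i * x i ^ 2)).
  { replace (sumN N (fun i => Rm i i * x i ^ 2)) with (/ INR N * (INR N * sumN N (fun i => Rm i i * x i ^ 2)))
      by (rewrite <- Rmult_assoc, Hi; ring).
    apply Rmult_le_compat_l; lra. }
  nra.
Qed.

(** The entries are nonnegative, so the form at x is at least minus the form at |x|, where the upper
    bound applies. *)
Lemma offdiag_quad_ge x : (1 <= N)%nat ->
  - (c * nM * sqnorm N x) <= sumN N (fun i => x i * matvec N (offdiag Rm) x i).
Proof.
  intros HN. pose proof (offdiag_quad_le (fun i => Rabs (x i)) HN) as H.
  assert (E : sqnorm N (fun i => Rabs (x i)) = sqnorm N x).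
  { apply sumN_ext; intros. now rewrite pow2_abs. }
  rewrite E in H. apply Ropp_le_cancel. rewrite Ropp_involutive. eapply Rle_trans; [|apply H].
  eapply Rle_trans; [apply Rle_abs|]. rewrite Rabs_Ropp. eapply Rle_trans; [apply sumN_abs|].
  apply sumN_le; intros i Hi. rewrite Rabs_mult. apply Rmult_le_compat_l; [apply Rabs_pos|].
  eapply Rle_trans; [apply sumN_abs|]. apply sumN_le; intros k Hk. rewrite Rabs_mult.
  apply Rmult_le_compat_r; [apply Rabs_pos|]. unfold offdiag.
  destruct (Nat.eqb k i); [rewrite Rabs_R0; lra|].
  rewrite Rabs_pos_eq; [lra|]. now apply pathmat_ge0.
Qed.

(** Polarization: the upper bound at u + w, the lower bound at u - w, and the parallelogram
    identity. *)
Lemma offdiag_bilinear u w : (1 <= N)%nat ->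
  2 * sumN N (fun i => u i * matvec N (offdiag Rm) w i)
  <= c * nM * (sqnorm N u + sqnorm N w).
Proof.
  intros HN.
  pose proof (offdiag_quad_le (fun i => u i + w i) HN) as Hp.
  pose proof (offdiag_quad_ge (fun i => u i - w i) HN) as Hm.
  assert (Hsym : forall i j, offdiag Rm i j = offdiag Rm j i).
  { intros i j. unfold offdiag. rewrite (Nat.eqb_sym j i), pathmat_sym. easy. }
  pose proof (matvec_adjoint N _ w u Hsym) as Ha.
  assert (Ha' : sumN N (fun i => w i * matvec N (offdiag Rm) u i)
     = sumN N (fun i => u i * matvec N (offdiag Rm) w i)).
  { rewrite Ha. apply sumN_ext; intros; ring. }
  assert (Hpol : 4 * sumN N (fun i => u i * matvec N (offdiag Rm) w i)
     = sumN N (fun i => (u i + w i) * matvec N (offdiag Rm) (fun i => u i + w i) i)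
       - sumN N (fun i => (u i - w i) * matvec N (offdiag Rm) (fun i => u i - w i) i)).
  { replace (4 * _) with (2 * sumN N (fun i => u i * matvec N (offdiag Rm) w i)
      + 2 * sumN N (fun i => w i * matvec N (offdiag Rm) u i)) by (rewrite Ha'; ring).
    rewrite <- !sumN_scal, <- sumN_plus, <- sumN_minus. apply sumN_ext; intros i Hi.
    rewrite matvec_plus, matvec_minus. ring. }
  assert (Hsq : sqnorm N (fun i => u i + w i) + sqnorm N (fun i => u i - w i)
     = 2 * (sqnorm N u + sqnorm N w)).
  { unfold sqnorm. rewrite <- !sumN_plus, <- sumN_scal. apply sumN_ext; intros; ring. }
  nra.
Qed.

(** The form in which delays meet the matrix: one factor [nM] comes from R d, the change of the
    exact prices, the other from the stale part. The absolute value appears because price errors are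
    bounded only entry by entry. *)
Lemma offdiag_cross d w : (1 <= N)%nat ->
  2 * sumN N (fun i => Rabs (matvec N Rm d i) * matvec N (offdiag Rm) w i)
  <= c * nM ^ 2 * (sqnorm N d + sqnorm N w).
Proof.
  intros HN. destruct (spectral_norm_bound N Rm nM Hn) as [Hn0 Hnb].
  set (u := fun i => Rabs (matvec N Rm d i)).
  assert (Hu : sqnorm N u <= nM ^ 2 * sqnorm N d).
  { eapply Rle_trans; [|apply Hnb]. right. apply sumN_ext; intros. unfold u. now rewrite pow2_abs. }
  assert (Hc : 0 <= c).
  { assert (1 <= INR N) by (apply (le_INR 1); easy).
    assert (/ INR N <= / 1) by (apply Rinv_le_contravar; lra). lra. }
  (* rescaling w by nM balances the two squares *)
  destruct (Req_dec nM 0) as [E|E].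
  - pose proof (offdiag_bilinear u w HN) as H. rewrite E in *. unfold u in H. nra.
  - pose proof (offdiag_bilinear u (fun i => nM * w i) HN) as H.
    rewrite sqnorm_scal in H.
    replace (sumN N (fun i => u i * matvec N (offdiag Rm) (fun i => nM * w i) i))
      with (nM * sumN N (fun i => u i * matvec N (offdiag Rm) w i)) in H.
    2:{ rewrite <- sumN_scal. apply sumN_ext; intros. rewrite matvec_scal. ring. }
    apply Rmult_le_reg_l with nM; [lra|].
    change (nM * (2 * sumN N (fun i => u i * matvec N (offdiag Rm) w i))
      <= nM * (c * nM ^ 2 * (sqnorm N d + sqnorm N w))).
    assert (c * nM * (sqnorm N u + nM ^ 2 * sqnorm N w)
      <= c * nM * (nM ^ 2 * sqnorm N d + nM ^ 2 * sqnorm N w)).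
    { apply Rmult_le_compat_l; [nra|lra]. }
    eapply Rle_trans; [|eapply Rle_trans; [apply H|eapply Rle_trans; [eassumption|]]]; right; ring.
Qed.

End OffDiagonal.

Lemma offdiag_factor_le_sqrt N : (1 <= N)%nat ->
  0 <= 1 - / INR N /\ 2 * (1 - / INR N) <= sqrt (INR N).
Proof.
  intros HN. assert (Hn : 1 <= INR N) by (apply (le_INR 1); easy). set (n := INR N) in *.
  assert (Hi : / n * n = 1) by (apply Rinv_l; lra).
  assert (0 < / n) by (apply Rinv_0_lt_compat; lra).
  assert (/ n <= 1) by nra. split; [lra|].
  apply Rsqr_incr_0_var; [|apply sqrt_pos]. rewrite Rsqr_sqrt by lra. unfold Rsqr.
  apply Rmult_le_reg_r with (n ^ 2); [nra|].
  replace (2 * (1 - / n) * (2 * (1 - / n)) * n ^ 2) with (4 * (n - 1) ^ 2) by (field; lra).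
  (* n^3 - 4 (n - 1)^2 = n (n - 2)^2 + 4 (n - 1). *)
  pose proof (pow2_ge_0 (n - 2)). nra.
Qed.

(** * Dual ascent with delayed prices *)

Lemma psum_ext f g t : (forall s, f s = g s) -> psum f t = psum g t.
Proof. intros H. induction t as [|t IH]; simpl; [easy|]. now rewrite IH, H. Qed.

Lemma psum_plus f g t : psum (fun s => f s + g s) t = psum f t + psum g t.
Proof. induction t as [|t IH]; simpl; [ring|]. rewrite IH. ring. Qed.

Lemma psum_scal a f t : psum (fun s => a * f s) t = a * psum f t.
Proof. induction t as [|t IH]; simpl; [ring|]. rewrite IH. ring. Qed.

Lemma psum_const a t : psum (fun _ => a) t = INR t * a.
Proof. induction t as [|t IH]; [simpl; ring|]. rewrite S_INR. simpl psum. rewrite IH. ring. Qed.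

Lemma psum_sumN N (f : nat -> nat -> R) t :
  psum (fun s => sumN N (fun k => f k s)) t = sumN N (fun k => psum (f k) t).
Proof.
  induction t as [|t IH]; simpl; [symmetry; apply sumN_zero|]. now rewrite IH, <- sumN_plus.
Qed.

Lemma past_le f g t n : (forall s, f s <= g s) -> past f t n <= past g t n.
Proof.
  intros H. unfold past. assert (Hu : (t - n <= t)%nat) by lia. revert Hu.
  generalize (t - n)%nat as u. intros u Hu. induction Hu as [|t' Hu IH]; [lra|].
  simpl. specialize (H t'). lra.
Qed.

Lemma past_scal a f t n : past (fun s => a * f s) t n = a * past f t n.
Proof. unfold past. rewrite !psum_scal. ring. Qed.

Lemma past_plus f g t n : past (fun s => f s + g s) t n = past f t n + past g t n.
Proof. unfold past. rewrite !psum_plus. ring. Qed.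

Lemma past_sumN N (f : nat -> nat -> R) t n :
  past (fun s => sumN N (fun k => f k s)) t n = sumN N (fun k => past (f k) t n).
Proof. unfold past. now rewrite !psum_sumN, <- sumN_minus. Qed.

Lemma past_const_le a t n : 0 <= a -> past (fun _ => a) t n <= INR n * a.
Proof.
  intros Ha. unfold past. rewrite !psum_const, <- Rmult_minus_distr_r, <- minus_INR by lia.
  apply Rmult_le_compat_r; [easy|]. apply le_INR. lia.
Qed.

(** Each time lies in at most n windows of length n. Lengthening all windows by one step adds the
    sum [E], which telescopes. *)
Lemma psum_past_le f n t : (forall s, 0 <= f s) ->
  psum (fun s => past f s n) t <= INR n * psum f t.
Proof.
  intros Hf. induction n as [|n IH].
  - rewrite (psum_ext _ (fun _ => 0)) by (intros; apply past_0). rewrite psum_const. simpl. lra.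
  - assert (E : psum (fun s => psum f (s - n) - psum f (s - S n)) t = psum f (t - S n)).
    { clear IH. induction t as [|t IH]; [easy|]. cbn [psum]. rewrite IH.
      replace (S t - S n)%nat with (t - n)%nat by lia. ring. }
    rewrite (psum_ext _ (fun s => past f s n + (psum f (s - n) - psum f (s - S n))))
      by (intros; unfold past; ring).
    rewrite psum_plus, E, S_INR.
    assert (psum f (t - S n) <= psum f t) by (apply psum_mono; [easy|lia]). lra.
Qed.

(** * Projections on intervals and half-lines *)

Lemma clamp_bounds x lo hi : lo <= hi -> lo <= clamp x lo hi <= hi.
Proof.
  intros H. unfold clamp, Rmin, Rmax.
  destruct (Rle_dec x lo), (Rle_dec lo hi), (Rle_dec x hi); lra.
Qed.

Lemma clamp_lipschitz x y lo hi : Rabs (clamp x lo hi - clamp y lo hi) <= Rabs (x - y).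
Proof.
  unfold clamp, Rmin, Rmax.
  destruct (Rle_dec x lo), (Rle_dec y lo), (Rle_dec lo hi), (Rle_dec x hi), (Rle_dec y hi);
    unfold Rabs; repeat destruct (Rcase_abs _); lra.
Qed.

Lemma clamp_affine_lipschitz a a' b lo hi z z' : 0 < a -> a <= a' ->
  a * Rabs (clamp ((z - b) / a') lo hi - clamp ((z' - b) / a') lo hi) <= Rabs (z - z').
Proof.
  intros Ha Haa.
  pose proof (clamp_lipschitz ((z - b) / a') ((z' - b) / a') lo hi) as H.
  replace ((z - b) / a' - (z' - b) / a') with ((z - z') / a') in H by (field; lra).
  unfold Rdiv in H. rewrite Rabs_mult, Rabs_inv, (Rabs_pos_eq a') in H by lra.
  apply Rmult_le_compat_l with (r := a') in H; [|lra].
  replace (a' * (Rabs (z - z') * / a')) with (Rabs (z - z')) in H by (field; lra).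
  eapply Rle_trans; [|apply H]. apply Rmult_le_compat_r; [apply Rabs_pos|easy].
Qed.

Lemma clamp_argmin a b z lo hi p : 0 < a -> lo <= p <= hi ->
  let h := clamp ((z - b) / a) lo hi in
  a / 2 * h ^ 2 + b * h - z * h + a / 2 * (p - h) ^ 2 <= a / 2 * p ^ 2 + b * p - z * p.
Proof.
  intros Ha Hp h. set (y := (z - b) / a). assert (Hz : z = b + a * y) by (unfold y; field; lra).
  (* y is the minimizer on the whole line and h its projection, so what remains is the obtuse-angle
     property of a projection. *)
  enough (0 <= a * ((h - y) * (p - h))) by (rewrite Hz; lra).
  apply Rmult_le_pos; [lra|]. unfold h. fold y. unfold clamp, Rmin, Rmax.
  destruct (Rle_dec y lo), (Rle_dec lo hi), (Rle_dec y hi); nra.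
Qed.

Lemma posp_variational l g s y : 0 <= y ->
  let l' := posp (l + s * g) in s * g * (y - l') <= (l' - l) * (y - l').
Proof.
  intros Hy l'. unfold l', posp, Rmax. destruct (Rle_dec (l + s * g) 0); nra.
Qed.

Lemma posp_ge0 x : 0 <= posp x.
Proof. apply Rmax_r. Qed.

Lemma young a x y : 0 < a -> x * y <= / (2 * a) * x ^ 2 + a / 2 * y ^ 2.
Proof.
  intros Ha. replace (_ + _) with (x * y + / (2 * a) * (x - a * y) ^ 2) by (field; lra).
  assert (0 < / (2 * a)) by (apply Rinv_0_lt_compat; lra).
  pose proof (pow2_ge_0 (x - a * y)). nra.
Qed.

(** * Limits of sequences *)

Lemma is_lim_seq_sumN N (f : nat -> nat -> R) (l : nat -> R) :
  (forall i, (1 <= i <= N)%nat -> is_lim_seq (f i) (l i)) ->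
  is_lim_seq (fun t => sumN N (fun i => f i t)) (sumN N l).
Proof.
  induction N as [|N IH]; intros H; [apply is_lim_seq_const|].
  rewrite sumN_S. apply is_lim_seq_ext with (fun t => sumN N (fun i => f i t) + f (S N) t).
  - intros t. now rewrite sumN_S.
  - apply is_lim_seq_plus'; [apply IH; intros|]; apply H; lia.
Qed.

Lemma is_lim_seq_sumN0 N (f : nat -> nat -> R) :
  (forall i, (1 <= i <= N)%nat -> is_lim_seq (f i) 0) ->
  is_lim_seq (fun t => sumN N (fun i => f i t)) 0.
Proof.
  intros H. rewrite <- (sumN_zero N). now apply is_lim_seq_sumN.
Qed.

Lemma is_lim_seq_scal' a u l : is_lim_seq u (Finite l) -> is_lim_seq (fun t => a * u t) (a * l).
Proof. apply (is_lim_seq_scal_l u a (Finite l)). Qed.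

Lemma is_lim_seq_scal0 a u : is_lim_seq u 0 -> is_lim_seq (fun t => a * u t) 0.
Proof. intros H. rewrite <- (Rmult_0_r a). now apply is_lim_seq_scal'. Qed.

Lemma is_lim_seq_plus0 u v : is_lim_seq u 0 -> is_lim_seq v 0 -> is_lim_seq (fun t => u t + v t) 0.
Proof. intros Hu Hv. rewrite <- (Rplus_0_r 0). now apply is_lim_seq_plus'. Qed.

Lemma is_lim_seq_squeeze0 u v : (forall t, 0 <= u t <= v t) -> is_lim_seq v 0 -> is_lim_seq u 0.
Proof. intros H Hv. apply is_lim_seq_le_le with (fun _ => 0) v; [easy|apply is_lim_seq_const|easy]. Qed.

Lemma is_lim_seq_abs_of_sq x : is_lim_seq (fun t => x t ^ 2) 0 -> is_lim_seq (fun t => Rabs (x t)) 0.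
Proof.
  intros H. rewrite <- sqrt_0.
  apply is_lim_seq_ext with (fun t => sqrt (x t ^ 2)).
  - intros t. rewrite <- (sqrt_Rsqr_abs (x t)). f_equal. unfold Rsqr. ring.
  - apply is_lim_seq_continuous; [apply continuity_pt_sqrt; lra|easy].
Qed.

Lemma past_lim0 f n : is_lim_seq f 0 -> is_lim_seq (fun t => past f t n) 0.
Proof.
  intros Hf. induction n as [|n IH].
  - apply is_lim_seq_ext with (fun _ => 0); [intros; now rewrite past_0|apply is_lim_seq_const].
  - apply is_lim_seq_ext with (fun t => past f t n + (psum f (t - n) - psum f (t - S n))).
    { intros t. unfold past. ring. }
    apply is_lim_seq_plus0; [easy|]. apply (is_lim_seq_incr_n _ (S n)).
    apply is_lim_seq_ext with f; [|easy]. intros t.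
    replace (t + S n - n)%nat with (S t) by lia. replace (t + S n - S n)%nat with t by lia.
    simpl. ring.
Qed.

Lemma summable_lim0 f K : (forall s, 0 <= f s) -> (forall T, psum f T <= K) -> is_lim_seq f 0.
Proof.
  intros Hf HK. destruct (ex_finite_lim_seq_incr (psum f) K) as [l Hl].
  - intros t. simpl. specialize (Hf t). lra.
  - easy.
  - apply is_lim_seq_ext with (fun t => psum f (S t) - psum f t); [intros; simpl; ring|].
    rewrite <- (Rminus_diag l). apply is_lim_seq_minus'; [|easy].
    now apply (is_lim_seq_incr_1 (psum f)).
Qed.

Lemma cauchy_of_square_bound u eta a : 0 < a -> is_lim_seq eta 0 ->
  (forall t s, a * (u t - u s) ^ 2 <= eta t + eta s) -> is_lim_seq u (real (Lim_seq u)).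
Proof.
  intros Ha He H. apply Lim_seq_correct', ex_lim_seq_cauchy_corr. intros eps.
  apply is_lim_seq_spec in He.
  assert (Hpos : 0 < a * eps ^ 2 / 2).
  { pose proof (cond_pos eps). apply Rmult_lt_0_compat; [|lra]. apply Rmult_lt_0_compat; [easy|nra]. }
  destruct (He (mkposreal _ Hpos)) as [T HT]. exists T. intros n m Hn Hm.
  pose proof (HT n Hn) as H1. pose proof (HT m Hm) as H2. simpl pos in H1, H2.
  rewrite Rminus_0_r in H1, H2. apply Rabs_def2 in H1, H2.
  specialize (H n m). pose proof (cond_pos eps).
  assert ((u n - u m) ^ 2 < eps ^ 2) by (apply Rmult_lt_reg_l with a; lra).
  apply Rabs_def1; nra.
Qed.

(** * Lagrangian duality for the voltage constraints *)

Section DualAscent.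
Context (N : nat) (Rm Xm : nat -> nat -> R) (v0 : R).
Context (vlo vup plo pup qlo qup aP bP cP aQ bQ cQ : nat -> R).
Context (a nR nX : R).
Hypothesis HRsym : forall i j, Rm i j = Rm j i.
Hypothesis HXsym : forall i j, Xm i j = Xm j i.
Hypothesis HnR : forall x, sqnorm N (matvec N Rm x) <= nR ^ 2 * sqnorm N x.
Hypothesis HnX : forall x, sqnorm N (matvec N Xm x) <= nX ^ 2 * sqnorm N x.
Hypothesis Ha : 0 < a.
Hypothesis HaP : forall i, (1 <= i <= N)%nat -> a <= aP i.
Hypothesis HaQ : forall i, (1 <= i <= N)%nat -> a <= aQ i.
Hypothesis Hp : forall i, (1 <= i <= N)%nat -> plo i <= pup i.
Hypothesis Hq : forall i, (1 <= i <= N)%nat -> qlo i <= qup i.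

Notation cst := (cost N aP bP cP aQ bQ cQ).
Notation vlt := (volt N Rm Xm v0).

Definition box (p q : nat -> R) : Prop := forall i, (1 <= i <= N)%nat ->
  plo i <= p i <= pup i /\ qlo i <= q i <= qup i.

Definition phat (z : nat -> R) (k : nat) : R := clamp ((z k - bP k) / aP k) (plo k) (pup k).
Definition qhat (z : nat -> R) (k : nat) : R := clamp ((z k - bQ k) / aQ k) (qlo k) (qup k).

Lemma hat_box z w : box (phat z) (qhat w).
Proof. intros i Hi. split; apply clamp_bounds; auto. Qed.

Definition sqdist (p q p' q' : nat -> R) : R :=
  sumN N (fun i => (p i - p' i) ^ 2 + (q i - q' i) ^ 2).

(** At fixed prices the minimization separates over nodes. The prices are arbitrary, so that the
    lemma serves both the exact prices of the dual function and the stale prices of the iterates. *)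
Lemma hat_argmin z w p q : box p q ->
  cst (phat z) (qhat w) + a / 2 * sqdist p q (phat z) (qhat w)
  + sumN N (fun i => z i * (p i - phat z i) + w i * (q i - qhat w i))
  <= cst p q.
Proof.
  intros Hb. unfold cost, sqdist. rewrite <- sumN_scal, <- !sumN_plus.
  apply sumN_le; intros i Hi. destruct (Hb i Hi) as [Hpi Hqi].
  pose proof (HaP i Hi) as H1. pose proof (HaQ i Hi) as H2.
  pose proof (clamp_argmin (aP i) (bP i) (z i) (plo i) (pup i) (p i) ltac:(lra) Hpi) as H3.
  pose proof (clamp_argmin (aQ i) (bQ i) (w i) (qlo i) (qup i) (q i) ltac:(lra) Hqi) as H4.
  cbv zeta in H3, H4. fold (phat z i) in H3. fold (qhat w i) in H4.
  pose proof (pow2_ge_0 (p i - phat z i)). pose proof (pow2_ge_0 (q i - qhat w i)).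
  assert (a / 2 * (p i - phat z i) ^ 2 <= aP i / 2 * (p i - phat z i) ^ 2)
    by (apply Rmult_le_compat_r; lra).
  assert (a / 2 * (q i - qhat w i) ^ 2 <= aQ i / 2 * (q i - qhat w i) ^ 2)
    by (apply Rmult_le_compat_r; lra).
  lra.
Qed.

Lemma phat_lipschitz z z' i : (1 <= i <= N)%nat ->
  a * Rabs (phat z i - phat z' i) <= Rabs (z i - z' i).
Proof. intros Hi. apply clamp_affine_lipschitz; auto. Qed.

Lemma qhat_lipschitz z z' i : (1 <= i <= N)%nat ->
  a * Rabs (qhat z i - qhat z' i) <= Rabs (z i - z' i).
Proof. intros Hi. apply clamp_affine_lipschitz; auto. Qed.

Lemma volt_diff p q p' q' i :
  vlt p q i - vlt p' q' i
  = matvec N Rm (fun j => p j - p' j) i + matvec N Xm (fun j => q j - q' j) i.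
Proof. unfold volt. rewrite !matvec_minus. ring. Qed.

(** Symmetry moves the matrices onto the multipliers, turning a pairing with voltages into a pairing
    of prices with powers. *)
Lemma volt_pairing m p q p' q' :
  sumN N (fun i => m i * (vlt p q i - vlt p' q' i))
  = sumN N (fun i => matvec N Rm m i * (p i - p' i) + matvec N Xm m i * (q i - q' i)).
Proof.
  rewrite sumN_plus, <- (matvec_adjoint N Rm m (fun j => p j - p' j) HRsym),
    <- (matvec_adjoint N Xm m (fun j => q j - q' j) HXsym), <- sumN_plus.
  apply sumN_ext; intros i Hi. rewrite volt_diff. ring.
Qed.

(** Linear in the multipliers: at the dual minimizers, with increments in place of multipliers, it
    is the directional derivative of the dual function. *)
Definition gap (l u p q : nat -> R) : R :=
  sumN N (fun i => l i * (vlo i - vlt p q i) + u i * (vlt p q i - vup i)).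

Definition lagrangian (l u p q : nat -> R) : R := cst p q + gap l u p q.

Definition net (l u : nat -> R) (i : nat) : R := l i - u i.

Definition dual_p (l u : nat -> R) : nat -> R := phat (matvec N Rm (net l u)).
Definition dual_q (l u : nat -> R) : nat -> R := qhat (matvec N Xm (net l u)).
Definition dual (l u : nat -> R) : R := lagrangian l u (dual_p l u) (dual_q l u).

Lemma gap_diff l u p q p' q' :
  gap l u p q - gap l u p' q' = - sumN N (fun i => net l u i * (vlt p q i - vlt p' q' i)).
Proof.
  unfold gap, net. rewrite <- sumN_minus, <- sumN_opp. apply sumN_ext; intros; ring.
Qed.

Lemma dual_argmin l u p q : box p q ->
  dual l u + a / 2 * sqdist p q (dual_p l u) (dual_q l u) <= lagrangian l u p q.
Proof.
  intros Hb. pose proof (hat_argmin (matvec N Rm (net l u)) (matvec N Xm (net l u)) p q Hb) as H.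
  fold (dual_p l u) (dual_q l u) in H. rewrite <- volt_pairing in H.
  pose proof (gap_diff l u p q (dual_p l u) (dual_q l u)).
  unfold dual, lagrangian. lra.
Qed.

Lemma sqdist_split p q p' q' :
  sqdist p q p' q' = sqnorm N (fun i => p i - p' i) + sqnorm N (fun i => q i - q' i).
Proof. unfold sqdist. now rewrite sumN_plus. Qed.

Lemma sumN_young x y :
  sumN N (fun i => x i * y i) <= / (2 * a) * sqnorm N x + a / 2 * sqnorm N y.
Proof.
  unfold sqnorm. rewrite <- !sumN_scal, <- sumN_plus. apply sumN_le; intros. now apply young.
Qed.

(** Smoothness of the dual function, obtained without differentiating it: the new minimizers are a
    trial point in the old Lagrangian, strong convexity yields (a/2) |dy|^2, and Young's inequality
    spends exactly this on the cross term. *)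
Lemma dual_ascent l u l' u' :
  dual l u
  + gap (fun i => l' i - l i) (fun i => u' i - u i) (dual_p l u) (dual_q l u)
  - (nR ^ 2 + nX ^ 2) / (2 * a) * sqnorm N (fun i => net l' u' i - net l u i)
  <= dual l' u'.
Proof.
  set (p' := dual_p l' u'). set (q' := dual_q l' u').
  set (p := dual_p l u). set (q := dual_q l u).
  set (dl := fun i => l' i - l i). set (du := fun i => u' i - u i).
  set (d := fun i => net l' u' i - net l u i).
  pose proof (dual_argmin l u p' q' (hat_box _ _)) as H1. fold p q in H1.
  assert (H2 : dual l' u' = lagrangian l u p' q' + gap dl du p' q').
  { unfold dual, lagrangian. fold p' q'. unfold gap.
    rewrite Rplus_assoc, <- sumN_plus. f_equal. apply sumN_ext; intros. unfold dl, du. ring. }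
  pose proof (gap_diff dl du p' q' p q) as H3.
  rewrite (sumN_ext _ _ (fun i => d i * (vlt p' q' i - vlt p q i))) in H3
    by (intros; unfold d, net, dl, du; ring).
  rewrite volt_pairing, sumN_plus in H3.
  pose proof (sumN_young (matvec N Rm d) (fun i => p' i - p i)) as H4.
  pose proof (sumN_young (matvec N Xm d) (fun i => q' i - q i)) as H5.
  rewrite sqdist_split in H1. cbv beta in *.
  assert (H6 : / (2 * a) * sqnorm N (matvec N Rm d) + / (2 * a) * sqnorm N (matvec N Xm d)
     <= (nR ^ 2 + nX ^ 2) / (2 * a) * sqnorm N d).
  { specialize (HnR d). specialize (HnX d).
    assert (0 < / (2 * a)) by (apply Rinv_0_lt_compat; lra). unfold Rdiv. nra. }
  lra.
Qed.

(** The slack term is kept because at a Slater point its weights are positive, so that it bounds the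
    multipliers. *)
Lemma weak_duality l u p q : (forall i, (1 <= i <= N)%nat -> 0 <= l i /\ 0 <= u i) -> box p q ->
  dual l u + sumN N (fun i => l i * (vlt p q i - vlo i) + u i * (vup i - vlt p q i)) <= cst p q.
Proof.
  intros Hlu Hb. pose proof (dual_argmin l u p q Hb) as H.
  assert (0 <= sqdist p q (dual_p l u) (dual_q l u)).
  { rewrite sqdist_split. pose proof (sqnorm_ge0 N (fun i => p i - dual_p l u i)).
    pose proof (sqnorm_ge0 N (fun i => q i - dual_q l u i)). lra. }
  unfold lagrangian, gap in H.
  assert (E : sumN N (fun i => l i * (vlo i - vlt p q i) + u i * (vlt p q i - vup i))
    = - sumN N (fun i => l i * (vlt p q i - vlo i) + u i * (vup i - vlt p q i))).
  { rewrite <- sumN_opp. apply sumN_ext; intros; ring. }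
  nra.
Qed.

(** * Summed increments of the dual value *)

Section Iteration.
Context (gamma c : R) (D : nat) (zP zQ lamL lamU : nat -> nat -> R).
(** Smoothness constant of the dual function in the net multiplier, equal to L / 2. *)
Notation l := ((nR ^ 2 + nX ^ 2) / a).
Notation lam t := (net (lamL t) (lamU t)).
Notation p t := (phat (zP t)).
Notation q t := (qhat (zQ t)).
Hypothesis Hc : 0 <= c.
Hypothesis HcR : forall d w,
  2 * sumN N (fun i => Rabs (matvec N Rm d i) * matvec N (offdiag Rm) w i)
  <= c * nR ^ 2 * (sqnorm N d + sqnorm N w).
Hypothesis HcX : forall d w,
  2 * sumN N (fun i => Rabs (matvec N Xm d i) * matvec N (offdiag Xm) w i)
  <= c * nX ^ 2 * (sqnorm N d + sqnorm N w).
Hypothesis Hgamma : 0 < gamma.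
Hypothesis Hkappa : 0 < / gamma - l * (1 + 2 * c * INR D).
Hypothesis Hinit : forall i, (1 <= i <= N)%nat -> lamL 0%nat i = 0 /\ lamU 0%nat i = 0.
Hypothesis Hlam : forall t i, (1 <= i <= N)%nat ->
  lamL (S t) i = posp (lamL t i + gamma * (vlo i - vlt (p t) (q t) i)) /\
  lamU (S t) i = posp (lamU t i + gamma * (vlt (p t) (q t) i - vup i)).
Notation window t := (fun k => past (incr (fun t => lam t) k) t D).
Hypothesis HzP : forall t i, (1 <= i <= N)%nat ->
  Rabs (zP t i - matvec N Rm (lam t) i) <= matvec N (offdiag Rm) (window t) i.
Hypothesis HzQ : forall t i, (1 <= i <= N)%nat ->
  Rabs (zQ t i - matvec N Xm (lam t) i) <= matvec N (offdiag Xm) (window t) i.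

Lemma lam_ge0 t i : (1 <= i <= N)%nat -> 0 <= lamL t i /\ 0 <= lamU t i.
Proof.
  intros Hi. destruct t as [|t].
  - destruct (Hinit i Hi) as [-> ->]. lra.
  - destruct (Hlam t i Hi) as [-> ->]. split; apply posp_ge0.
Qed.

Definition dlam t i := lam (S t) i - lam t i.
Definition dsq t := sqnorm N (dlam t).
Definition msq t :=
  sumN N (fun i => (lamL (S t) i - lamL t i) ^ 2 + (lamU (S t) i - lamU t i) ^ 2).

Lemma msq_ge0 t : 0 <= msq t.
Proof. apply sumN_ge0; intros i Hi. apply Rplus_le_le_0_compat; apply pow2_ge_0. Qed.

Lemma dsq_le t : dsq t <= 2 * msq t.
Proof.
  unfold dsq, msq, sqnorm, dlam, net. rewrite <- sumN_scal. apply sumN_le; intros i Hi.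
  pose proof (pow2_ge_0 ((lamL (S t) i - lamL t i) + (lamU (S t) i - lamU t i))). nra.
Qed.

Lemma gap_step t :
  / gamma * msq t
  <= gap (fun i => lamL (S t) i - lamL t i) (fun i => lamU (S t) i - lamU t i) (p t) (q t).
Proof.
  unfold msq, gap. rewrite <- sumN_scal. apply sumN_le; intros i Hi.
  destruct (Hlam t i Hi) as [HL HU]. destruct (lam_ge0 t i Hi) as [HL0 HU0].
  set (gL := vlo i - vlt (p t) (q t) i) in *. set (gU := vlt (p t) (q t) i - vup i) in *.
  (* The test point is the old multiplier, which makes the right side minus the square of the
     increment. *)
  pose proof (posp_variational (lamL t i) gL gamma (lamL t i) HL0) as H1.
  pose proof (posp_variational (lamU t i) gU gamma (lamU t i) HU0) as H2.
  cbv zeta in H1, H2. rewrite <- HL in H1. rewrite <- HU in H2.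
  apply Rmult_le_reg_l with gamma; [easy|].
  rewrite <- Rmult_assoc, Rinv_r, Rmult_1_l by lra. nra.
Qed.

(** The pairing is moved inside the window and bounded at each past time separately, so the current
    increment is charged up to D times and each past one once. *)
Lemma window_pairing M nM t :
  (forall d w, 2 * sumN N (fun i => Rabs (matvec N M d i) * matvec N (offdiag M) w i)
     <= c * nM ^ 2 * (sqnorm N d + sqnorm N w)) ->
  sumN N (fun i => Rabs (matvec N M (dlam t) i) * matvec N (offdiag M) (window t) i)
  <= c * nM ^ 2 / 2 * (INR D * dsq t + past dsq t D).
Proof.
  intros HM.
  rewrite (sumN_ext _ _ (fun i => past (fun s => Rabs (matvec N M (dlam t) i)
     * matvec N (offdiag M) (fun k => incr (fun t => lam t) k s) i) t D)).
  2:{ intros i Hi. rewrite past_scal. f_equal. unfold matvec. rewrite past_sumN.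
      apply sumN_ext; intros k Hk. now rewrite past_scal. }
  rewrite <- past_sumN.
  eapply Rle_trans; [apply past_le with (g := fun s => c * nM ^ 2 / 2 * dsq t + c * nM ^ 2 / 2 * dsq s)|].
  - intros s. specialize (HM (dlam t) (fun k => incr (fun t => lam t) k s)).
    assert (E : sqnorm N (fun k => incr (fun t => lam t) k s) = dsq s).
    { apply sumN_ext; intros. unfold incr, dlam. now rewrite pow2_abs. }
    rewrite E in HM. fold (dsq t) in HM. lra.
  - rewrite past_plus, (past_scal _ dsq).
    assert (0 <= c * nM ^ 2 / 2 * dsq t).
    { apply Rmult_le_pos; [|apply sqnorm_ge0]. pose proof (pow2_ge_0 nM). nra. }
    pose proof (past_const_le (c * nM ^ 2 / 2 * dsq t) t D H). lra.
Qed.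

(** The clamped minimizers are 1/a-Lipschitz in the price, so after multiplication by a the error of
    the powers is at most the price error, that is, the stale window. *)
Lemma delay_loss t :
  - (l * c / 2 * (INR D * dsq t + past dsq t D))
  <= sumN N (fun i => dlam t i * (vlt (p t) (q t) i
        - vlt (dual_p (lamL t) (lamU t)) (dual_q (lamL t) (lamU t)) i)).
Proof.
  rewrite volt_pairing. set (p' := dual_p _ _). set (q' := dual_q _ _).
  pose proof (window_pairing Rm nR t HcR) as HR. pose proof (window_pairing Xm nX t HcX) as HX.
  apply Rmult_le_reg_l with a; [easy|].
  apply Rle_trans with (- (sumN N (fun i => Rabs (matvec N Rm (dlam t) i) * matvec N (offdiag Rm) (window t) i)
     + sumN N (fun i => Rabs (matvec N Xm (dlam t) i) * matvec N (offdiag Xm) (window t) i))).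
  - replace (a * _) with (- ((nR ^ 2 + nX ^ 2) * c / 2 * (INR D * dsq t + past dsq t D))) by (field; lra).
    lra.
  - rewrite <- sumN_plus, <- sumN_scal, <- sumN_opp.
    apply sumN_le; intros i Hi.
    pose proof (phat_lipschitz (zP t) (matvec N Rm (lam t)) i Hi) as H1.
    pose proof (qhat_lipschitz (zQ t) (matvec N Xm (lam t)) i Hi) as H2.
    specialize (HzP t i Hi). specialize (HzQ t i Hi).
    fold (dual_p (lamL t) (lamU t)) in H1. fold (dual_q (lamL t) (lamU t)) in H2. fold p' in H1. fold q' in H2.
    assert (G : forall x y W, a * Rabs y <= W -> - (Rabs x * W) <= a * (x * y)).
    { intros x y W HW. pose proof (Rabs_pos x). pose proof (Rle_abs (- (x * y))) as Hxy.
      rewrite Rabs_Ropp, Rabs_mult in Hxy. nra. }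
    pose proof (G (matvec N Rm (dlam t) i) _ _ (Rle_trans _ _ _ H1 HzP)).
    pose proof (G (matvec N Xm (dlam t) i) _ _ (Rle_trans _ _ _ H2 HzQ)).
    lra.
Qed.

Notation dualt t := (dual (lamL t) (lamU t)).

Lemma dual_step t :
  dualt t + / gamma * msq t - l / 2 * dsq t - l * c / 2 * (INR D * dsq t + past dsq t D)
  <= dualt (S t).
Proof.
  pose proof (dual_ascent (lamL t) (lamU t) (lamL (S t)) (lamU (S t))) as H1.
  pose proof (gap_step t) as H2. pose proof (delay_loss t) as H3.
  pose proof (gap_diff (fun i => lamL (S t) i - lamL t i) (fun i => lamU (S t) i - lamU t i)
    (p t) (q t) (dual_p (lamL t) (lamU t)) (dual_q (lamL t) (lamU t))) as H4.
  rewrite (sumN_ext _ _ (fun i => dlam t i * (vlt (p t) (q t) i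
        - vlt (dual_p (lamL t) (lamU t)) (dual_q (lamL t) (lamU t)) i))) in H4
    by (intros; unfold dlam, net; ring).
  fold (dlam t) in H1. change (fun i : nat => lam (S t) i - lam t i) with (dlam t) in H1. fold (dsq t) in H1.
  replace ((nR ^ 2 + nX ^ 2) / (2 * a) * dsq t) with (l / 2 * dsq t) in H1 by (field; lra).
  lra.
Qed.

Lemma dual_growth T :
  dualt 0%nat + (/ gamma - l * (1 + 2 * c * INR D)) * psum msq T <= dualt T.
Proof.
  assert (Hl : 0 <= l).
  { unfold Rdiv. apply Rmult_le_pos; [pose proof (pow2_ge_0 nR); pose proof (pow2_ge_0 nX); lra|].
    apply Rlt_le, Rinv_0_lt_compat; easy. }
  assert (Hds : forall s, 0 <= dsq s) by (intros; apply sqnorm_ge0).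
  assert (H : dualt 0%nat + / gamma * psum msq T - l / 2 * psum dsq T
     - l * c / 2 * (INR D * psum dsq T + psum (fun t => past dsq t D) T) <= dualt T).
  { induction T as [|T IH]; cbn [psum]; [lra|]. pose proof (dual_step T). lra. }
  eapply Rle_trans; [|apply H].
  (* Current and past charges give l c D in all. Passing from [dsq] to [msq] doubles l / 2 + l c D
     into l (1 + 2 c D). *)
  pose proof (psum_past_le dsq D T Hds) as H1.
  assert (H2 : psum dsq T <= 2 * psum msq T).
  { rewrite <- psum_scal. apply psum_le, dsq_le. }
  assert (0 <= INR D) by apply pos_INR.
  assert (l * c * psum (fun t => past dsq t D) T <= l * c * (INR D * psum dsq T))
    by (apply Rmult_le_compat_l; [apply Rmult_le_pos; easy|easy]).
  assert (l * (1 + 2 * c * INR D) * psum dsq T <= l * (1 + 2 * c * INR D) * (2 * psum msq T)).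
  { apply Rmult_le_compat_l; [|easy]. apply Rmult_le_pos; [easy|].
    assert (0 <= c * INR D) by (now apply Rmult_le_pos). lra. }
  lra.
Qed.

(** * Bounds from a Slater point *)

Context (ps qs : nat -> R).
Hypothesis Hslater : forall i, (1 <= i <= N)%nat ->
  plo i <= ps i <= pup i /\ qlo i <= qs i <= qup i /\ vlo i < vlt ps qs i < vup i.

Lemma slater_sum_ge0 t i : (1 <= i <= N)%nat ->
  0 <= lamL t i * (vlt ps qs i - vlo i) /\ 0 <= lamU t i * (vup i - vlt ps qs i).
Proof.
  intros Hi. destruct (Hslater i Hi) as [_ [_ Hv]]. destruct (lam_ge0 t i Hi).
  split; apply Rmult_le_pos; lra.
Qed.

Lemma slater_box : box ps qs.
Proof. intros i Hi. split; apply (Hslater i Hi). Qed.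

Lemma msq_summable : exists K, forall T, psum msq T <= K.
Proof.
  exists ((cst ps qs - dualt 0%nat) / (/ gamma - l * (1 + 2 * c * INR D))). intros T.
  apply Rmult_le_reg_l with (/ gamma - l * (1 + 2 * c * INR D)); [easy|].
  pose proof (dual_growth T) as H1.
  pose proof (weak_duality (lamL T) (lamU T) ps qs (lam_ge0 T) slater_box) as H2.
  assert (0 <= sumN N (fun i => lamL T i * (vlt ps qs i - vlo i) + lamU T i * (vup i - vlt ps qs i))).
  { apply sumN_ge0; intros i Hi. destruct (slater_sum_ge0 T i Hi). lra. }
  set (k := / gamma - l * (1 + 2 * c * INR D)) in *.
  replace (k * ((cst ps qs - dualt 0%nat) / k)) with (cst ps qs - dualt 0%nat) by (field; lra).
  lra.
Qed.

(** By [dual_growth] the dual value stays above its initial value, so weak duality at the Slater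
    point bounds a positively weighted sum of the multipliers. *)
Lemma lam_bounded : exists M, 0 <= M /\ forall t i, (1 <= i <= N)%nat -> lamL t i <= M /\ lamU t i <= M.
Proof.
  set (K := cst ps qs - dualt 0%nat).
  assert (Hsum : forall t,
    sumN N (fun i => lamL t i * (vlt ps qs i - vlo i) + lamU t i * (vup i - vlt ps qs i)) <= K).
  { intros t. pose proof (weak_duality (lamL t) (lamU t) ps qs (lam_ge0 t) slater_box).
    pose proof (dual_growth t). assert (0 <= psum msq t).
    { change 0 with (psum msq 0). apply psum_mono; [apply msq_ge0|lia]. }
    unfold K. nra. }
  assert (Hterm : forall t i, (1 <= i <= N)%nat ->
    lamL t i * (vlt ps qs i - vlo i) + lamU t i * (vup i - vlt ps qs i) <= K).
  { intros t i Hi. eapply Rle_trans; [|apply (Hsum t)].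
    apply (sumN_term_le N (fun i => lamL t i * (vlt ps qs i - vlo i) + lamU t i * (vup i - vlt ps qs i))); [easy|].
    intros j Hj. destruct (slater_sum_ge0 t j Hj). lra. }
  (* Absolute values keep every [B i] nonnegative, so that the sum is one bound for all nodes. *)
  set (B := fun i => Rabs (K / (vlt ps qs i - vlo i)) + Rabs (K / (vup i - vlt ps qs i))).
  assert (HB : forall i, 0 <= B i).
  { intros i. unfold B. pose proof (Rabs_pos (K / (vlt ps qs i - vlo i))).
    pose proof (Rabs_pos (K / (vup i - vlt ps qs i))). lra. }
  exists (sumN N B). split; [now apply sumN_ge0|]. intros t i Hi.
  assert (HBi : B i <= sumN N B) by (now apply sumN_term_le).
  destruct (Hslater i Hi) as [_ [_ Hv]]. destruct (slater_sum_ge0 t i Hi). specialize (Hterm t i Hi).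
  unfold B in HBi at 1.
  pose proof (Rabs_pos (K / (vlt ps qs i - vlo i))). pose proof (Rabs_pos (K / (vup i - vlt ps qs i))).
  assert (Hdiv : forall x s, 0 < s -> x * s <= K -> x <= Rabs (K / s)).
  { intros x s Hs Hx. eapply Rle_trans; [|apply Rle_abs]. apply Rmult_le_reg_r with s; [easy|].
    replace (K / s * s) with K by (field; lra). easy. }
  split.
  - enough (lamL t i <= Rabs (K / (vlt ps qs i - vlo i))) by lra. apply Hdiv; lra.
  - enough (lamU t i <= Rabs (K / (vup i - vlt ps qs i))) by lra. apply Hdiv; lra.
Qed.

(** * Convergence of the powers *)

Section Limit.
Context (M : R).
Hypothesis HM0 : 0 <= M.
Hypothesis HM : forall t i, (1 <= i <= N)%nat -> lamL t i <= M /\ lamU t i <= M.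
Hypothesis Hmsq : is_lim_seq msq 0.

Definition mabs (i t : nat) : R :=
  Rabs (lamL (S t) i - lamL t i) + Rabs (lamU (S t) i - lamU t i).

Lemma mabs_lim0 i : (1 <= i <= N)%nat -> is_lim_seq (mabs i) 0.
Proof.
  intros Hi.
  assert (H : forall t, (lamL (S t) i - lamL t i) ^ 2 + (lamU (S t) i - lamU t i) ^ 2 <= msq t).
  { intros t. apply (sumN_term_le N
      (fun i => (lamL (S t) i - lamL t i) ^ 2 + (lamU (S t) i - lamU t i) ^ 2)); [easy|].
    intros; apply Rplus_le_le_0_compat; apply pow2_ge_0. }
  apply is_lim_seq_plus0; apply is_lim_seq_abs_of_sq; apply is_lim_seq_squeeze0 with msq; try easy;
    intros t; specialize (H t);
    pose proof (pow2_ge_0 (lamL (S t) i - lamL t i)); pose proof (pow2_ge_0 (lamU (S t) i - lamU t i)); lra.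
Qed.

Lemma incr_lim0 k : (1 <= k <= N)%nat -> is_lim_seq (incr (fun t => lam t) k) 0.
Proof.
  intros Hk. apply is_lim_seq_squeeze0 with (mabs k); [|now apply mabs_lim0].
  intros t. split; [apply incr_ge0|]. unfold incr, mabs, net.
  replace (_ - _) with ((lamL (S t) k - lamL t k) + - (lamU (S t) k - lamU t k)) by ring.
  eapply Rle_trans; [apply Rabs_triang|]. rewrite Rabs_Ropp. lra.
Qed.

(** The comparison is with the multipliers of time t + 1, which are those the projection inequality
    describes; the shift costs one more increment. *)
Lemma price_error_lim0 Mx z i : (1 <= i <= N)%nat ->
  (forall t i, (1 <= i <= N)%nat ->
    Rabs (z t i - matvec N Mx (lam t) i) <= matvec N (offdiag Mx) (window t) i) ->
  is_lim_seq (fun t => Rabs (z t i - matvec N Mx (lam (S t)) i)) 0.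
Proof.
  intros Hi Hz.
  apply is_lim_seq_squeeze0 with (fun t => matvec N (offdiag Mx) (window t) i
    + Rabs (matvec N Mx (dlam t) i)).
  - intros t. split; [apply Rabs_pos|]. unfold dlam. rewrite matvec_minus.
    replace (z t i - matvec N Mx (lam (S t)) i) with ((z t i - matvec N Mx (lam t) i)
      + - (matvec N Mx (fun j => lam (S t) j) i - matvec N Mx (fun j => lam t j) i))
      by (change (fun j => lam (S t) j) with (lam (S t)); change (fun j => lam t j) with (lam t); ring).
    eapply Rle_trans; [apply Rabs_triang|]. rewrite Rabs_Ropp. apply Rplus_le_compat_r. now apply Hz.
  - apply is_lim_seq_plus0.
    + apply is_lim_seq_sumN0 with (f := fun k t => offdiag Mx i k * window t k).
      intros k Hk. apply is_lim_seq_scal0. now apply past_lim0, incr_lim0.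
    + apply (is_lim_seq_abs_0 (fun t => matvec N Mx (dlam t) i)).
      apply is_lim_seq_sumN0 with (f := fun k t => Mx i k * dlam t k).
      intros k Hk. apply is_lim_seq_scal0. apply is_lim_seq_abs_0. now apply incr_lim0.
Qed.

Definition eP (i t : nat) : R := Rabs (zP t i - matvec N Rm (lam (S t)) i).
Definition eQ (i t : nat) : R := Rabs (zQ t i - matvec N Xm (lam (S t)) i).

(** Defect of iterate t in the optimality conditions at node i: the projection residual for
    multipliers up to [M], and the price errors times the widths of the box. *)
Definition slack (i t : nat) : R :=
  M / gamma * mabs i t + eP i t * (pup i - plo i) + eQ i t * (qup i - qlo i).
Definition eta (t : nat) : R := sumN N (fun i => slack i t).

Lemma eta_lim0 : is_lim_seq eta 0.
Proof.
  apply is_lim_seq_sumN0. intros i Hi. unfold slack.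
  apply is_lim_seq_plus0; [apply is_lim_seq_plus0|].
  - now apply is_lim_seq_scal0, mabs_lim0.
  - apply is_lim_seq_ext with (fun t => (pup i - plo i) * eP i t); [intros; ring|].
    now apply is_lim_seq_scal0, price_error_lim0.
  - apply is_lim_seq_ext with (fun t => (qup i - qlo i) * eQ i t); [intros; ring|].
    now apply is_lim_seq_scal0, price_error_lim0.
Qed.

(** The new multiplier nearly maximizes a linear function on [0, M]: the defect is its increment
    over gamma, times a distance of at most M. *)
Lemma multiplier_variational t i y : (1 <= i <= N)%nat -> 0 <= y <= M ->
  (vlo i - vlt (p t) (q t) i) * (y - lamL (S t) i) <= M / gamma * Rabs (lamL (S t) i - lamL t i) /\
  (vlt (p t) (q t) i - vup i) * (y - lamU (S t) i) <= M / gamma * Rabs (lamU (S t) i - lamU t i).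
Proof.
  intros Hi Hy. destruct (Hlam t i Hi) as [HL HU].
  destruct (lam_ge0 (S t) i Hi) as [L0 U0]. destruct (HM (S t) i Hi) as [L1 U1].
  assert (G : forall l0 g l', l' = posp (l0 + gamma * g) -> 0 <= l' <= M ->
     g * (y - l') <= M / gamma * Rabs (l' - l0)).
  { intros l0 g l' E Hl'. pose proof (posp_variational l0 g gamma y (proj1 Hy)) as H.
    cbv zeta in H. rewrite <- E in H.
    apply Rmult_le_reg_l with gamma; [easy|].
    replace (gamma * (M / gamma * Rabs (l' - l0))) with (M * Rabs (l' - l0)) by (field; lra).
    assert ((l' - l0) * (y - l') <= M * Rabs (l' - l0)); [|lra].
    eapply Rle_trans; [apply Rle_abs|]. rewrite Rabs_mult, Rmult_comm.
    apply Rmult_le_compat_r; [apply Rabs_pos|]. apply Rabs_le. lra. }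
  split; now apply G.
Qed.

Lemma sqdist_sym p1 q1 p2 q2 : sqdist p1 q1 p2 q2 = sqdist p2 q2 p1 q1.
Proof. apply sumN_ext; intros; ring. Qed.

Lemma error_pairing z m x lo hi y y' :
  z = m + x -> lo <= y <= hi -> lo <= y' <= hi -> m * (y - y') - Rabs x * (hi - lo) <= z * (y - y').
Proof.
  intros -> Hy Hy'. pose proof (Rle_abs (- (x * (y - y')))) as H.
  rewrite Rabs_Ropp, Rabs_mult in H.
  assert (Rabs (y - y') <= hi - lo) by (apply Rabs_le; lra).
  pose proof (Rabs_pos x). nra.
Qed.

Lemma price_pairing t p' q' : box p' q' ->
  sumN N (fun i => lam (S t) i * (vlt p' q' i - vlt (p t) (q t) i)
     - eP i t * (pup i - plo i) - eQ i t * (qup i - qlo i))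
  <= sumN N (fun i => zP t i * (p' i - p t i) + zQ t i * (q' i - q t i)).
Proof.
  intros Hb. rewrite !sumN_minus, volt_pairing, <- !sumN_minus. apply sumN_le; intros i Hi.
  destruct (Hb i Hi) as [H1 H2]. destruct (hat_box (zP t) (zQ t) i Hi) as [H3 H4].
  pose proof (error_pairing (zP t i) (matvec N Rm (lam (S t)) i) (zP t i - matvec N Rm (lam (S t)) i)
    (plo i) (pup i) (p' i) (p t i) ltac:(ring) H1 H3).
  pose proof (error_pairing (zQ t i) (matvec N Xm (lam (S t)) i) (zQ t i - matvec N Xm (lam (S t)) i)
    (qlo i) (qup i) (q' i) (q t i) ltac:(ring) H2 H4).
  unfold eP, eQ. lra.
Qed.

(** Each iterate is a competitor of the other and the costs cancel. Up to price errors there remains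
    (lam(s+1) - lam(t+1)) . (v(t) - v(s)), which the projection inequalities of both times, tested
    at the multipliers of the other, bound from below. *)
Lemma iterate_cauchy t s : a * sqdist (p t) (q t) (p s) (q s) <= eta t + eta s.
Proof.
  pose proof (hat_argmin (zP t) (zQ t) (p s) (q s) (hat_box _ _)) as H1.
  pose proof (hat_argmin (zP s) (zQ s) (p t) (q t) (hat_box _ _)) as H2.
  pose proof (price_pairing t (p s) (q s) (hat_box _ _)) as H3.
  pose proof (price_pairing s (p t) (q t) (hat_box _ _)) as H4.
  rewrite (sqdist_sym (p s)) in H1.
  enough (- (eta t + eta s) <=
     sumN N (fun i => lam (S t) i * (vlt (p s) (q s) i - vlt (p t) (q t) i)
       - eP i t * (pup i - plo i) - eQ i t * (qup i - qlo i))
     + sumN N (fun i => lam (S s) i * (vlt (p t) (q t) i - vlt (p s) (q s) i)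
       - eP i s * (pup i - plo i) - eQ i s * (qup i - qlo i))) by lra.
  unfold eta. rewrite <- !sumN_plus, <- sumN_opp. apply sumN_le; intros i Hi.
  destruct (lam_ge0 (S t) i Hi), (lam_ge0 (S s) i Hi), (HM (S t) i Hi), (HM (S s) i Hi).
  destruct (multiplier_variational t i (lamL (S s) i) Hi) as [V1 _]; [lra|].
  destruct (multiplier_variational t i (lamU (S s) i) Hi) as [_ V2]; [lra|].
  destruct (multiplier_variational s i (lamL (S t) i) Hi) as [V3 _]; [lra|].
  destruct (multiplier_variational s i (lamU (S t) i) Hi) as [_ V4]; [lra|].
  unfold slack, mabs, net. lra.
Qed.

Lemma iterate_near_optimal t p' q' : feasible N Rm Xm v0 vlo vup plo pup qlo qup p' q' ->
  cst (p t) (q t) + a / 2 * sqdist p' q' (p t) (q t) - eta t <= cst p' q'.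
Proof.
  intros Hf. assert (Hb : box p' q') by (intros i Hi; split; apply (Hf i Hi)).
  pose proof (hat_argmin (zP t) (zQ t) p' q' Hb) as H1.
  pose proof (price_pairing t p' q' Hb) as H2.
  enough (- eta t <= sumN N (fun i => lam (S t) i * (vlt p' q' i - vlt (p t) (q t) i)
     - eP i t * (pup i - plo i) - eQ i t * (qup i - qlo i))) by lra.
  unfold eta. rewrite <- sumN_opp. apply sumN_le; intros i Hi.
  (* The test point 0 gives approximate complementary slackness. *)
  destruct (multiplier_variational t i 0 Hi) as [V1 V2]; [lra|].
  destruct (lam_ge0 (S t) i Hi). destruct (Hf i Hi) as [[F1 F2] _].
  assert (0 <= lamL (S t) i * (vlt p' q' i - vlo i)) by (apply Rmult_le_pos; lra).
  assert (0 <= lamU (S t) i * (vup i - vlt p' q' i)) by (apply Rmult_le_pos; lra).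
  unfold slack, mabs, net. lra.
Qed.

(** A positive part is at least its argument, so a violation of size e raises the multiplier by at
    least gamma e. *)
Lemma near_feasible t i : (1 <= i <= N)%nat ->
  vlo i - / gamma * mabs i t <= vlt (p t) (q t) i <= vup i + / gamma * mabs i t.
Proof.
  intros Hi. destruct (Hlam t i Hi) as [HL HU].
  pose proof (Rmax_l (lamL t i + gamma * (vlo i - vlt (p t) (q t) i)) 0) as H1.
  pose proof (Rmax_l (lamU t i + gamma * (vlt (p t) (q t) i - vup i)) 0) as H2.
  fold (posp (lamL t i + gamma * (vlo i - vlt (p t) (q t) i))) in H1.
  fold (posp (lamU t i + gamma * (vlt (p t) (q t) i - vup i))) in H2.
  rewrite <- HL in H1. rewrite <- HU in H2.
  pose proof (Rle_abs (lamL (S t) i - lamL t i)). pose proof (Rle_abs (lamU (S t) i - lamU t i)).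
  pose proof (Rabs_pos (lamL (S t) i - lamL t i)). pose proof (Rabs_pos (lamU (S t) i - lamU t i)).
  assert (Hg : / gamma * mabs i t * gamma = mabs i t) by (field; lra). unfold mabs in Hg at 2.
  split; apply Rmult_le_reg_r with gamma; lra.
Qed.

Definition pstar (i : nat) : R := Lim_seq (fun t => p t i).
Definition qstar (i : nat) : R := Lim_seq (fun t => q t i).

Lemma iterate_lim i : (1 <= i <= N)%nat ->
  is_lim_seq (fun t => p t i) (pstar i) /\ is_lim_seq (fun t => q t i) (qstar i).
Proof.
  intros Hi.
  assert (H : forall t s, a * ((p t i - p s i) ^ 2 + (q t i - q s i) ^ 2) <= eta t + eta s).
  { intros t s. eapply Rle_trans; [|apply iterate_cauchy]. apply Rmult_le_compat_l; [lra|].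
    apply (sumN_term_le N (fun i => (p t i - p s i) ^ 2 + (q t i - q s i) ^ 2)); [easy|].
    intros; apply Rplus_le_le_0_compat; apply pow2_ge_0. }
  assert (Hlim : forall u, (forall t s, a * (u t - u s) ^ 2 <= eta t + eta s) ->
    is_lim_seq u (real (Lim_seq u))).
  { intros u Hu. exact (cauchy_of_square_bound u eta a Ha eta_lim0 Hu). }
  split; apply Hlim; intros t s; eapply Rle_trans; [|apply (H t s)| |apply (H t s)];
    (apply Rmult_le_compat_l; [lra|]);
    pose proof (pow2_ge_0 (p t i - p s i)); pose proof (pow2_ge_0 (q t i - q s i)); lra.
Qed.

Lemma is_lim_seq_quadratic x l c2 c1 c0 : is_lim_seq x (Finite l) ->
  is_lim_seq (fun t => c2 * x t ^ 2 + c1 * x t + c0) (c2 * l ^ 2 + c1 * l + c0).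
Proof.
  intros H. apply is_lim_seq_plus'; [|apply is_lim_seq_const].
  apply is_lim_seq_plus'; apply is_lim_seq_scal'; [|easy]. simpl.
  apply is_lim_seq_mult'; [easy|]. apply is_lim_seq_mult'; [easy|apply is_lim_seq_const].
Qed.

Lemma cost_lim : is_lim_seq (fun t => cst (p t) (q t)) (cst pstar qstar).
Proof.
  apply is_lim_seq_plus'.
  - apply is_lim_seq_sumN with (f := fun i t => aP i / 2 * p t i ^ 2 + bP i * p t i + cP i).
    intros i Hi. apply (is_lim_seq_quadratic (fun t => p t i) (pstar i)). exact (proj1 (iterate_lim i Hi)).
  - apply is_lim_seq_sumN with (f := fun i t => aQ i / 2 * q t i ^ 2 + bQ i * q t i + cQ i).
    intros i Hi. apply (is_lim_seq_quadratic (fun t => q t i) (qstar i)). exact (proj2 (iterate_lim i Hi)).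
Qed.

Lemma sqdist_lim p' q' :
  is_lim_seq (fun t => sqdist p' q' (p t) (q t)) (sqdist p' q' pstar qstar).
Proof.
  apply is_lim_seq_sumN with (f := fun i t => (p' i - p t i) ^ 2 + (q' i - q t i) ^ 2).
  assert (G : forall (x : nat -> R) (l y : R), is_lim_seq x l ->
    is_lim_seq (fun t => (y - x t) ^ 2) ((y - l) ^ 2)).
  { intros x l y H. pose proof (is_lim_seq_minus' _ _ _ _ (is_lim_seq_const y) H) as Hd.
    apply is_lim_seq_ext with (fun t => (y - x t) * (y - x t)); [intros; ring|].
    replace ((y - l) ^ 2) with ((y - l) * (y - l)) by ring. exact (is_lim_seq_mult' _ _ _ _ Hd Hd). }
  intros i Hi. destruct (iterate_lim i Hi) as [H1 H2].
  exact (is_lim_seq_plus' _ _ _ _ (G _ _ (p' i) H1) (G _ _ (q' i) H2)).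
Qed.

Lemma volt_lim i : (1 <= i <= N)%nat ->
  is_lim_seq (fun t => vlt (p t) (q t) i) (vlt pstar qstar i).
Proof.
  intros Hi. apply is_lim_seq_plus'; [|apply is_lim_seq_const].
  apply is_lim_seq_plus'.
  - apply is_lim_seq_sumN with (f := fun j t => Rm i j * p t j).
    intros j Hj. apply (is_lim_seq_scal' (Rm i j) (fun t => p t j) (pstar j)). exact (proj1 (iterate_lim j Hj)).
  - apply is_lim_seq_sumN with (f := fun j t => Xm i j * q t j).
    intros j Hj. apply (is_lim_seq_scal' (Xm i j) (fun t => q t j) (qstar j)). exact (proj2 (iterate_lim j Hj)).
Qed.

Lemma limit_feasible : feasible N Rm Xm v0 vlo vup plo pup qlo qup pstar qstar.
Proof.
  intros i Hi. destruct (iterate_lim i Hi) as [H1 H2].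
  assert (Hle : forall u v (x y : R), (forall t, u t <= v t) -> is_lim_seq u x -> is_lim_seq v y -> x <= y).
  { intros u v x y Huv Hu Hv. exact (is_lim_seq_le u v x y Huv Hu Hv). }
  pose proof (is_lim_seq_scal0 (/ gamma) _ (mabs_lim0 i Hi)) as H3.
  split; [|split]; split.
  - apply (Hle (fun t => vlo i - / gamma * mabs i t) (fun t => vlt (p t) (q t) i)).
    + intros t. now apply near_feasible.
    + replace (Finite (vlo i)) with (Finite (vlo i - 0)) by (f_equal; ring). apply is_lim_seq_minus'; [apply is_lim_seq_const|easy].
    + now apply volt_lim.
  - apply (Hle (fun t => vlt (p t) (q t) i) (fun t => vup i + / gamma * mabs i t)).
    + intros t. now apply near_feasible.
    + now apply volt_lim.
    + replace (Finite (vup i)) with (Finite (vup i + 0)) by (f_equal; ring). apply is_lim_seq_plus'; [apply is_lim_seq_const|easy].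
  - apply (Hle (fun _ => plo i) (fun t => p t i)); [|apply is_lim_seq_const|easy].
    intros t. now apply (hat_box (zP t) (zQ t)).
  - apply (Hle (fun t => p t i) (fun _ => pup i)); [|easy|apply is_lim_seq_const].
    intros t. now apply (hat_box (zP t) (zQ t)).
  - apply (Hle (fun _ => qlo i) (fun t => q t i)); [|apply is_lim_seq_const|easy].
    intros t. now apply (hat_box (zP t) (zQ t)).
  - apply (Hle (fun t => q t i) (fun _ => qup i)); [|easy|apply is_lim_seq_const].
    intros t. now apply (hat_box (zP t) (zQ t)).
Qed.

Lemma limit_strongly_optimal p' q' : feasible N Rm Xm v0 vlo vup plo pup qlo qup p' q' ->
  cst pstar qstar + a / 2 * sqdist p' q' pstar qstar <= cst p' q'.
Proof.
  intros Hf.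
  assert (H : is_lim_seq (fun t => cst (p t) (q t) + a / 2 * sqdist p' q' (p t) (q t) - eta t)
     (cst pstar qstar + a / 2 * sqdist p' q' pstar qstar - 0)).
  { apply is_lim_seq_minus'; [|apply eta_lim0]. apply is_lim_seq_plus'; [apply cost_lim|].
    apply is_lim_seq_scal', sqdist_lim. }
  rewrite Rminus_0_r in H.
  exact (is_lim_seq_le _ _ _ _ (fun t => iterate_near_optimal t p' q' Hf) H (is_lim_seq_const _)).
Qed.

Lemma distance_to_limit : is_lim_seq (fun t => sqdist (p t) (q t) pstar qstar) 0.
Proof.
  apply is_lim_seq_ext with (fun t => sqdist pstar qstar (p t) (q t)); [intros; apply sqdist_sym|].
  rewrite <- (sumN_zero N), <- (sumN_ext N (fun i => (pstar i - pstar i) ^ 2 + (qstar i - qstar i) ^ 2))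
    by (intros; ring).
  apply sqdist_lim.
Qed.

End Limit.

Lemma delayed_dual_ascent_converges : exists ps' qs',
  feasible N Rm Xm v0 vlo vup plo pup qlo qup ps' qs' /\
  (forall p' q', feasible N Rm Xm v0 vlo vup plo pup qlo qup p' q' ->
    cst ps' qs' + a / 2 * sqdist p' q' ps' qs' <= cst p' q') /\
  is_lim_seq (fun t => sqdist (p t) (q t) ps' qs') 0.
Proof.
  destruct msq_summable as [K HK]. destruct lam_bounded as [M [HM0 HM]].
  pose proof (summable_lim0 msq K msq_ge0 HK) as Hmsq.
  exists pstar, qstar. split; [|split].
  - now apply limit_feasible with M.
  - now apply limit_strongly_optimal with M.
  - now apply distance_to_limit with M.
Qed.

End Iteration.
End DualAscent.

(** * Convergence of DIST-OPT *)

Lemma fold_Rmin_le b l x : In x l -> fold_right Rmin b l <= x.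
Proof.
  induction l as [|y l IH]; [easy|]. simpl. intros [->|H]; [apply Rmin_l|].
  eapply Rle_trans; [apply Rmin_r|auto].
Qed.

Lemma fold_Rmin_pos b l : 0 < b -> (forall x, In x l -> 0 < x) -> 0 < fold_right Rmin b l.
Proof.
  intros Hb. induction l as [|y l IH]; intros H; [easy|]. simpl.
  apply Rmin_glb_lt; [apply H; now left|apply IH; intros; apply H; now right].
Qed.

Lemma amin_spec N aP aQ : (1 <= N)%nat ->
  (forall i, (1 <= i <= N)%nat -> 0 < aP i) -> (forall i, (1 <= i <= N)%nat -> 0 < aQ i) ->
  0 < amin N aP aQ /\
  (forall i, (1 <= i <= N)%nat -> amin N aP aQ <= aP i) /\
  (forall i, (1 <= i <= N)%nat -> amin N aP aQ <= aQ i).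
Proof.
  intros HN HP HQ. unfold amin. split; [|split].
  - apply fold_Rmin_pos; [apply HP; lia|]. intros y Hy.
    apply in_app_iff in Hy. destruct Hy as [Hy|Hy]; apply in_map_iff in Hy;
      destruct Hy as [i [<- Hi]]; apply in_seq in Hi; [apply HP|apply HQ]; lia.
  - intros i Hi. apply fold_Rmin_le, in_app_iff. left. apply in_map, in_seq. lia.
  - intros i Hi. apply fold_Rmin_le, in_app_iff. right. apply in_map, in_seq. lia.
Qed.

(** The announced bound has D + 1 for D and s for 2 c; both only enlarge the denominator. *)
Lemma step_size_margin gamma l c s D : 0 < gamma -> 0 <= l -> 0 <= c -> 2 * c <= s ->
  gamma < 2 / ((1 + INR (D + 1) * s) * (2 * l)) ->
  0 < / gamma - l * (1 + 2 * c * INR D).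
Proof.
  intros Hg Hl Hc Hs H. assert (HD : 0 <= INR D) by apply pos_INR.
  rewrite plus_INR in H. simpl (INR 1) in H.
  destruct (Req_dec l 0) as [->|Hl0].
  (* the hypothesis then reads gamma < 2 / 0 = 0 *)
  { unfold Rdiv in H. rewrite !Rmult_0_r, Rinv_0 in H. lra. }
  assert (Hden : 0 < (1 + (INR D + 1) * s) * (2 * l)) by (apply Rmult_lt_0_compat; nra).
  apply Rmult_lt_compat_r with (r := (1 + (INR D + 1) * s) * (2 * l)) in H; [|easy].
  replace (2 / ((1 + (INR D + 1) * s) * (2 * l)) * ((1 + (INR D + 1) * s) * (2 * l))) with 2 in H
    by (field; split; nra).
  apply Rmult_lt_reg_l with gamma; [easy|].
  rewrite Rmult_0_r, Rmult_minus_distr_l, Rinv_r by lra.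
  assert (1 + 2 * c * INR D <= 1 + (INR D + 1) * s) by nra.
  assert (gamma * (l * (1 + 2 * c * INR D)) <= gamma * (l * (1 + (INR D + 1) * s))).
  { apply Rmult_le_compat_l; [lra|]. now apply Rmult_le_compat_l. }
  lra.
Qed.

Theorem theorem1
  (N : nat) (sigma : nat -> nat) (r x : nat -> R) (v0 : R)
  (vlo vup plo pup qlo qup aP bP cP aQ bQ cQ : nat -> R)
  (gamma : R) (taumax : nat) (tauU tauD : nat -> nat -> nat)
  (nR nX : R)
  (zP zQ lamL lamU alpha betaP betaQ halpha hbetaP hbetaQ : nat -> nat -> R)
  (* radial network *)
  (Htree : is_radial_tree N sigma)
  (Hr : forall k, (1 <= k <= N)%nat -> 0 <= r k)
  (Hx : forall k, (1 <= k <= N)%nat -> 0 <= x k)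
  (* problem data *)
  (Hv : forall i, (1 <= i <= N)%nat -> vlo i <= vup i)
  (Hp : forall i, (1 <= i <= N)%nat -> plo i <= pup i)
  (Hq : forall i, (1 <= i <= N)%nat -> qlo i <= qup i)
  (HaP : forall i, (1 <= i <= N)%nat -> 0 < aP i)
  (HaQ : forall i, (1 <= i <= N)%nat -> 0 < aQ i)
  (* Slater's condition *)
  (Hslater : exists p q, forall i, (1 <= i <= N)%nat ->
      plo i < p i < pup i /\ qlo i < q i < qup i /\
      vlo i < volt N (pathmat N sigma r) (pathmat N sigma x) v0 p q i < vup i)
  (* spectral norms of R and X *)
  (HnR : is_spectral_norm N (pathmat N sigma r) nR)
  (HnX : is_spectral_norm N (pathmat N sigma x) nX)
  (* bounded delays *)
  (HtauU : forall j t, (1 <= j <= N)%nat -> sigma j <> 0%nat -> (tauU j t <= taumax)%nat)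
  (HtauD : forall j t, (1 <= j <= N)%nat -> sigma j <> 0%nat -> (tauD j t <= taumax)%nat)
  (* step size *)
  (Hgamma : 0 < gamma /\
     gamma < 2 / ((1 + INR ((taumax + 1) * diam N sigma + 1) * sqrt (INR N))
                  * (2 * (nR ^ 2 + nX ^ 2) / amin N aP aQ)))
  (* initialization *)
  (Hinit : forall i, (1 <= i <= N)%nat ->
     zP 0%nat i = 0 /\ zQ 0%nat i = 0 /\ lamL 0%nat i = 0 /\ lamU 0%nat i = 0 /\
     alpha 0%nat i = 0 /\ betaP 0%nat i = 0 /\ betaQ 0%nat i = 0 /\
     halpha 0%nat i = 0 /\ hbetaP 0%nat i = 0 /\ hbetaQ 0%nat i = 0)
  (Hroot : forall i t, (1 <= i <= N)%nat -> sigma i = 0%nat ->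
     hbetaP t i = 0 /\ hbetaQ t i = 0)
  (* steps (1)-(2): multipliers *)
  (Hlam : forall t i, (1 <= i <= N)%nat ->
     let p := fun k => clamp ((zP t k - bP k) / aP k) (plo k) (pup k) in
     let q := fun k => clamp ((zQ t k - bQ k) / aQ k) (qlo k) (qup k) in
     let v := volt N (pathmat N sigma r) (pathmat N sigma x) v0 p q in
     lamL (S t) i = posp (lamL t i + gamma * (vlo i - v i)) /\
     lamU (S t) i = posp (lamU t i + gamma * (v i - vup i)))
  (* step (3): messages *)
  (Halpha : forall t i, (1 <= i <= N)%nat ->
     alpha (S t) i = (lamL (S t) i - lamU (S t) i) + sumC N sigma i (halpha t))
  (Hbeta : forall t j, (1 <= j <= N)%nat -> sigma j <> 0%nat ->
     let i := sigma j in
     betaP (S t) j = pathmat N sigma r i i *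
        ((lamL (S t) i - lamU (S t) i) + sumC' N sigma i j (halpha t)) + hbetaP t i /\
     betaQ (S t) j = pathmat N sigma x i i *
        ((lamL (S t) i - lamU (S t) i) + sumC' N sigma i j (halpha t)) + hbetaQ t i)
  (Hhat : forall t j, (1 <= j <= N)%nat -> sigma j <> 0%nat ->
     halpha (S t) j = delayed (fun s => alpha s j) (S t) (tauU j t) /\
     hbetaP (S t) j = delayed (fun s => betaP s j) (S t) (tauD j t) /\
     hbetaQ (S t) j = delayed (fun s => betaQ s j) (S t) (tauD j t))
  (* step (4) *)
  (Hz : forall t i, (1 <= i <= N)%nat ->
     zP (S t) i = pathmat N sigma r i i *
        ((lamL (S t) i - lamU (S t) i) + sumC N sigma i (halpha (S t))) + hbetaP (S t) i /\
     zQ (S t) i = pathmat N sigma x i i *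
        ((lamL (S t) i - lamU (S t) i) + sumC N sigma i (halpha (S t))) + hbetaQ (S t) i)
  : exists pstar qstar : nat -> R,
      optimal N (pathmat N sigma r) (pathmat N sigma x) v0
        vlo vup plo pup qlo qup aP bP cP aQ bQ cQ pstar qstar /\
      (forall p' q', optimal N (pathmat N sigma r) (pathmat N sigma x) v0
          vlo vup plo pup qlo qup aP bP cP aQ bQ cQ p' q' ->
        forall i, (1 <= i <= N)%nat -> p' i = pstar i /\ q' i = qstar i) /\
      (forall eps, 0 < eps -> exists T, forall t, (T <= t)%nat ->
         sqrt (sumN N (fun i =>
            (clamp ((zP t i - bP i) / aP i) (plo i) (pup i) - pstar i) ^ 2
          + (clamp ((zQ t i - bQ i) / aQ i) (qlo i) (qup i) - qstar i) ^ 2)) < eps).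
Proof.
  (* Without nodes the base value [aP 1] of [amin] is unconstrained and 1 / N is meaningless, so
     this case is settled apart. *)
  destruct (Nat.eq_dec N 0) as [->|HN0].
  { exists (fun _ => 0), (fun _ => 0). split; [split|split].
    - intros i Hi. lia.
    - intros. unfold cost. rewrite !sumN_0. lra.
    - intros. lia.
    - intros eps Heps. exists 0%nat. intros. rewrite sumN_0, sqrt_0. easy. }
  assert (HN : (1 <= N)%nat) by lia.
  destruct (amin_spec N aP aQ HN HaP HaQ) as [Ha [HaP' HaQ']]. set (a := amin N aP aQ) in *.
  destruct (offdiag_factor_le_sqrt N HN) as [Hc Hcs].
  destruct (spectral_norm_bound _ _ _ HnR) as [_ HbR].
  destruct (spectral_norm_bound _ _ _ HnX) as [_ HbX].
  set (D := ((taumax + 1) * diam N sigma)%nat) in *.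
  assert (Hl : 0 <= (nR ^ 2 + nX ^ 2) / a).
  { apply Rmult_le_pos; [|now apply Rlt_le, Rinv_0_lt_compat].
    apply Rplus_le_le_0_compat; apply pow2_ge_0. }
  assert (Hkappa : 0 < / gamma - (nR ^ 2 + nX ^ 2) / a * (1 + 2 * (1 - / INR N) * INR D)).
  { apply step_size_margin with (sqrt (INR N)); try easy.
    replace (2 * ((nR ^ 2 + nX ^ 2) / a)) with (2 * (nR ^ 2 + nX ^ 2) / a) by (field; lra). easy. }
  destruct Hslater as [ps [qs Hs]].
  assert (Hs' : forall i, (1 <= i <= N)%nat -> plo i <= ps i <= pup i /\ qlo i <= qs i <= qup i /\
    vlo i < volt N (pathmat N sigma r) (pathmat N sigma x) v0 ps qs i < vup i).
  { intros i Hi. destruct (Hs i Hi) as [? [? ?]]. repeat split; lra. }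
  set (lam := fun t => net (lamL t) (lamU t)).
  assert (Hlam0 : forall k, (1 <= k <= N)%nat -> lam 0%nat k = 0).
  { intros k Hk. destruct (Hinit k Hk) as [_ [_ [E1 [E2 _]]]]. unfold lam, net. lra. }
  assert (Halpha0 : forall i, (1 <= i <= N)%nat -> alpha 0%nat i = 0) by (intros; now apply Hinit).
  assert (Hhalpha : forall t j, (1 <= j <= N)%nat -> sigma j <> 0%nat ->
    exists u, (u <= t <= u + taumax)%nat /\ halpha t j = alpha u j).
  { intros [|t] j Hj Hsj.
    (* At time 0 the received value and the message are both 0, so the former counts as fresh. *)
    - exists 0%nat. split; [lia|]. rewrite Halpha0 by easy. now apply Hinit.
    - destruct (Hhat t j Hj Hsj) as [-> _]. specialize (HtauU j t Hj Hsj).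
      destruct (delayed_eq (fun s => alpha s j) (S t) (tauU j t) (Halpha0 j Hj)) as [u [Hu E]].
      exists u. split; [lia|easy]. }
  assert (HeP : forall t i, (1 <= i <= N)%nat ->
    Rabs (zP t i - matvec N (pathmat N sigma r) (lam t) i)
    <= matvec N (offdiag (pathmat N sigma r)) (fun k => past (incr lam k) t D) i).
  { intros t i Hi.
    apply (z_error N sigma Htree taumax lam alpha halpha Hlam0 Halpha0 Hhalpha Halpha r Hr
      betaP hbetaP zP); try easy.
    - intros j Hj. now apply Hinit.
    - intros j s Hj Hsj. now apply Hroot.
    - intros [|s] j Hj Hsj; destruct (Hinit j Hj) as [_ [_ [_ [_ [_ [B0 [_ [_ [B1 _]]]]]]]]].
      + exists 0%nat. split; [lia|]. now rewrite B0, B1.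
      + destruct (Hhat s j Hj Hsj) as [_ [-> _]]. specialize (HtauD j s Hj Hsj).
        destruct (delayed_eq (fun s => betaP s j) (S s) (tauD j s) B0) as [u [Hu E]].
        exists u. split; [lia|easy].
    - intros s j Hj Hsj. now apply Hbeta.
    - intros j Hj. now apply Hinit.
    - intros s j Hj. now apply Hz. }
  assert (HeQ : forall t i, (1 <= i <= N)%nat ->
    Rabs (zQ t i - matvec N (pathmat N sigma x) (lam t) i)
    <= matvec N (offdiag (pathmat N sigma x)) (fun k => past (incr lam k) t D) i).
  { intros t i Hi.
    apply (z_error N sigma Htree taumax lam alpha halpha Hlam0 Halpha0 Hhalpha Halpha x Hx
      betaQ hbetaQ zQ); try easy.
    - intros j Hj. now apply Hinit.
    - intros j s Hj Hsj. now apply Hroot.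
    - intros [|s] j Hj Hsj; destruct (Hinit j Hj) as [_ [_ [_ [_ [_ [_ [B0 [_ [_ B1]]]]]]]]].
      + exists 0%nat. split; [lia|]. now rewrite B0, B1.
      + destruct (Hhat s j Hj Hsj) as [_ [_ ->]]. specialize (HtauD j s Hj Hsj).
        destruct (delayed_eq (fun s => betaQ s j) (S s) (tauD j s) B0) as [u [Hu E]].
        exists u. split; [lia|easy].
    - intros s j Hj Hsj. now apply Hbeta.
    - intros j Hj. now apply Hinit.
    - intros s j Hj. now apply Hz. }
  destruct (delayed_dual_ascent_converges N (pathmat N sigma r) (pathmat N sigma x) v0
    vlo vup plo pup qlo qup aP bP cP aQ bQ cQ a nR nX) with (gamma := gamma) (c := 1 - / INR N)
    (D := D) (zP := zP) (zQ := zQ) (lamL := lamL) (lamU := lamU) (ps := ps) (qs := qs)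
    as [pst [qst [Hf [Hopt Hlim]]]]; try easy.
  - apply pathmat_sym.
  - apply pathmat_sym.
  - intros. now apply offdiag_cross.
  - intros. now apply offdiag_cross.
  - intros i Hi. destruct (Hinit i Hi) as [_ [_ [E1 [E2 _]]]]. easy.
  - assert (Hdist : forall p1 q1 p2 q2 i, (1 <= i <= N)%nat ->
      (p1 i - p2 i) ^ 2 + (q1 i - q2 i) ^ 2 <= sqdist N p1 q1 p2 q2).
    { intros p1 q1 p2 q2 i Hi.
      apply (sumN_term_le N (fun i => (p1 i - p2 i) ^ 2 + (q1 i - q2 i) ^ 2)); [easy|].
      intros; apply Rplus_le_le_0_compat; apply pow2_ge_0. }
    assert (Hdist0 : forall p1 q1 p2 q2, 0 <= sqdist N p1 q1 p2 q2).
    { intros. apply sumN_ge0; intros; apply Rplus_le_le_0_compat; apply pow2_ge_0. }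
    exists pst, qst. split; [split; [easy|]|split].
    + intros p' q' Hf'. specialize (Hopt p' q' Hf'). specialize (Hdist0 p' q' pst qst). nra.
    + intros p' q' [Hf' Hopt'] i Hi. specialize (Hopt p' q' Hf'). specialize (Hopt' pst qst Hf).
      specialize (Hdist p' q' pst qst i Hi).
      pose proof (pow2_ge_0 (p' i - pst i)). pose proof (pow2_ge_0 (q' i - qst i)).
      assert (sqdist N p' q' pst qst <= 0) by (apply Rmult_le_reg_l with (a / 2); lra).
      split; nra.
    + intros eps Heps. apply is_lim_seq_spec in Hlim.
      assert (He2 : 0 < eps ^ 2) by nra.
      destruct (Hlim (mkposreal _ He2)) as [T HT]. exists T. intros t Ht. specialize (HT t Ht).
      simpl pos in HT. rewrite Rminus_0_r in HT. apply Rabs_def2 in HT.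
      rewrite <- (sqrt_pow2 eps) by lra. apply sqrt_lt_1_alt. split; [apply Hdist0|apply HT].
Qed.
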